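(* Suppose that $\mu=\otimes_{k\in\mathcal K}\mu_k$ with $\mu_k=\sum_{l\in\mathcal L}\mu_k^l\delta_{x_k^l}$ for every $k\in\mathcal K$ and that $\nu_t=t\delta_{\boldsymbol y_1}+(1-t)\delta_{\boldsymbol y_2}$ with $\boldsymbol y_1,\boldsymbol y_2\in\mathbb R^K$ and $t\in[0,1]$, and let $\varepsilon>0$ be an error tolerance. If $c(\boldsymbol x,\boldsymbol y)=\|\boldsymbol x-\boldsymbol y\|^2$ and if all probabilities and all coordinates of the support points of $\mu$ and $\nu_t$ are representable as fractions of two integers with absolute values of at most $U$, then the optimal transport distance $W_c(\mu,\nu_t)$ can be computed to within an absolute error of at most $\varepsilon$ by a (dynamic programming-type) algorithm using $\mathcal O(KL\log_2(KL)+K^6U^8/\varepsilon^4)$ arithmetic operations. The bit lengths of all numbers computed by this algorithm are polynomially bounded in $K$, $L$, $\log_2(U)$ and $\log_2(\frac1\varepsilon)$.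
   Context: $\mathcal K=\{1,\dots,K\}$, $\mathcal L=\{1,\dots,L\}$; $x_k^l\in\mathbb R$ are the support points and $\mu_k^l\ge0$, $\sum_l\mu_k^l=1$, the probabilities of the $k$-th marginal $\mu_k$, and $\mu$ is the product distribution. $U$ is a positive integer. $\|\cdot\|$ is the Euclidean norm. The algorithm receives as input the numbers $x_k^l$, $\mu_k^l$ ($k\in\mathcal K$, $l\in\mathcal L$), the vectors $\boldsymbol y_1,\boldsymbol y_2$, the probability $t$ and the tolerance $\varepsilon$; the (up to $L^K$) atoms of $\mu$ are not enumerated in the input. For discrete distributions $\mu=\sum_i\mu_i\delta_{\boldsymbol x_i}$ and $\nu=\sum_j\nu_j\delta_{\boldsymbol y_j}$ on $\mathbb R^K$, the optimal transport distance is $W_c(\mu,\nu)=\min_{\boldsymbol\pi}\sum_{i,j}c(\boldsymbol x_i,\boldsymbol y_j)\pi_{ij}$, with the minimum over all nonnegative matrices $\boldsymbol\pi$ with row sums $\mu_i$ and column sums $\nu_j$. Arithmetic operations (additions, subtractions, multiplications, divisions, comparisons, and rounding to a nearest integer) are counted at unit cost, irrespective of the bit lengths of the operands. *)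

(* Defs.v *)
From HB Require Import structures.
From mathcomp Require Import all_boot all_order all_algebra.
From mathcomp Require Import all_classical all_reals all_analysis.

Set Implicit Arguments.
Unset Strict Implicit.
Unset Printing Implicit Defensive.

Import Order.TTheory GRing.Theory Num.Theory.

Local Open Scope ring_scope.

(** * Discrete optimal transport *)

(* The formal combination \sum_i wt_i \delta_(pt_i); points may repeat. *)
Record ddistr (R : realType) (T : Type) := DDistr {
  idx : finType;
  pt : idx -> T;
  wt : idx -> R }.

Definition coupling (R : realType) (T : Type) (m n : ddistr R T)
    (pi : idx m -> idx n -> R) : Prop :=
  [/\ forall i j, 0 <= pi i j,
      forall i, \sum_j pi i j = wt i
    & forall j, \sum_i pi i j = wt j].

Definition transport_cost (R : realType) (T : Type) (c : T -> T -> R)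
    (m n : ddistr R T) (pi : idx m -> idx n -> R) : R :=
  \sum_i \sum_j c (pt i) (pt j) * pi i j.

(* w = W_c(m, n), i.e. w is the minimum of the transport problem. *)
Definition is_OT_distance (R : realType) (T : Type) (c : T -> T -> R)
    (m n : ddistr R T) (w : R) : Prop :=
  (exists2 pi : idx m -> idx n -> R,
     coupling pi & w = transport_cost c pi) /\
  (forall pi : idx m -> idx n -> R,
     coupling pi -> w <= transport_cost c pi).

(* The library norm on row vectors is the sup norm. *)
Definition enorm (R : realType) (n : nat) (v : 'rV[R]_n) : R :=
  Num.sqrt (\sum_i v 0 i ^+ 2).

Definition sq_dist (R : realType) (n : nat) (u v : 'rV[R]_n) : R :=
  enorm (u - v) ^+ 2.

(* Row k of x and mu holds the support points and the probabilities of the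
   k-th marginal; an atom of the product picks one index in every row. *)
Definition product_distr (R : realType) (K L : nat) (x mu : 'M[R]_(K, L)) :
    ddistr R 'rV[R]_K :=
  @DDistr R 'rV[R]_K {ffun 'I_K -> 'I_L}
    (fun f => \row_k x k (f k)) (fun f => \prod_k mu k (f k)).

Definition two_point_distr (R : realType) (K : nat) (t : R)
    (y1 y2 : 'rV[R]_K) : ddistr R 'rV[R]_K :=
  @DDistr R 'rV[R]_K bool
    (fun b => if b then y1 else y2) (fun b => if b then t else 1 - t).

(** * Sizes of numbers *)

Definition log2 (R : realType) (r : R) : R := ln r / ln 2.

Definition is_fraction (R : realType) (U : nat) (r : R) : Prop :=
  exists p q : int,
    [/\ q != 0, `|p| <= U%:Z, `|q| <= U%:Z & r = p%:~R / q%:~R].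

(* Number of binary digits (one digit for 0). *)
Definition nat_bits (n : nat) : nat := (trunc_log 2 n).+1.

(* Sign, numerator and denominator of the reduced fraction. *)
Definition rat_bits (q : rat) : nat :=
  (1 + nat_bits `|numq q| + nat_bits `|denq q|)%N.

(** * Algorithms

   Algorithms are the programs of a while language over scalar variables and
   one-dimensional arrays, all holding numbers.  Semantics is partial: a
   program gets stuck on a division by 0 and on an array index that is not a
   natural number.  Array indices are therefore computed with the same counted
   operations as all other numbers.

   An execution yields a trace with one entry per arithmetic operation:
   [Some v] for an addition, subtraction, multiplication, division or rounding
   with result v, and [None] for a comparison.  Constants, memory accesses and
   sequencing are not logged; as every conditional and every iteration of a
   loop performs a comparison, the number of all elementary steps is at most
   proportional (with a factor depending on the program) to one plus the
   length of the trace. *)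

Inductive binop := Add | Sub | Mul | Div.

Inductive expr :=
  | Const of int
  | Var of nat
  | Elem of nat & expr                  (* Elem a e is a[e] *)
  | Bin of binop & expr & expr
  | Round of expr.

Inductive relop := Le | Lt | Eq.

Inductive cmd :=
  | Skip
  | Assign of nat & expr
  | Store of nat & expr & expr          (* Store a e1 e2 is a[e1] := e2 *)
  | Seq of cmd & cmd
  | If of relop & expr & expr & cmd & cmd
  | While of relop & expr & expr & cmd.

Record state (R : realType) := State {
  var : nat -> R;
  arr : nat -> nat -> R }.

Definition set_var (R : realType) (s : state R) (i : nat) (v : R) : state R :=
  State (fun i' => if i' == i then v else var s i') (arr s).

Definition set_arr (R : realType) (s : state R) (a n : nat) (v : R) :
    state R :=
  State (var s)
    (fun a' n' => if (a' == a) && (n' == n) then v else arr s a' n').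

Definition trace (R : realType) := seq (option R).

Definition nb_operations (R : realType) (tr : trace R) : nat := size tr.

Definition computed_numbers (R : realType) (tr : trace R) : seq R :=
  pmap id tr.

Definition apply_binop (R : realType) (o : binop) (u v : R) : option R :=
  match o with
  | Add => Some (u + v)
  | Sub => Some (u - v)
  | Mul => Some (u * v)
  | Div => if v == 0 then None else Some (u / v)
  end.

(* Ties are rounded upwards. *)
Definition round_nearest (R : realType) (v : R) : R :=
  (Num.floor (v + 2^-1))%:~R.

Definition apply_relop (R : realType) (o : relop) (u v : R) : bool :=
  match o with
  | Le => u <= v
  | Lt => u < v
  | Eq => u == v
  end.

Fixpoint eval (R : realType) (s : state R) (e : expr) : option (R * trace R) :=
  match e with
  | Const z => Some (z%:~R, [::])
  | Var i => Some (var s i, [::])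
  | Elem a e1 =>
      if eval s e1 is Some (v, tr) then
        if v \is a Num.nat then Some (arr s a (Num.truncn v), tr) else None
      else None
  | Bin o e1 e2 =>
      if eval s e1 is Some (v1, tr1) then
        if eval s e2 is Some (v2, tr2) then
          if apply_binop o v1 v2 is Some v then
            Some (v, tr1 ++ tr2 ++ [:: Some v])
          else None
        else None
      else None
  | Round e1 =>
      if eval s e1 is Some (v, tr) then
        Some (round_nearest v, tr ++ [:: Some (round_nearest v)])
      else None
  end.

Definition eval_test (R : realType) (s : state R) (o : relop) (e1 e2 : expr) :
    option (bool * trace R) :=
  if eval s e1 is Some (v1, tr1) then
    if eval s e2 is Some (v2, tr2) then
      Some (apply_relop o v1 v2, tr1 ++ tr2 ++ [:: None])
    else None
  else None.

(* exec c s s' tr: started in s, the program c terminates in s' with trace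
   tr. *)
Inductive exec (R : realType) :
    cmd -> state R -> state R -> trace R -> Prop :=
  | ExecSkip s : exec Skip s s [::]
  | ExecAssign i e s v tr :
      eval s e = Some (v, tr) ->
      exec (Assign i e) s (set_var s i v) tr
  | ExecStore a e1 e2 s n v tr1 tr2 :
      eval s e1 = Some (n%:R, tr1) ->
      eval s e2 = Some (v, tr2) ->
      exec (Store a e1 e2) s (set_arr s a n v) (tr1 ++ tr2)
  | ExecSeq c1 c2 s s1 s2 tr1 tr2 :
      exec c1 s s1 tr1 ->
      exec c2 s1 s2 tr2 ->
      exec (Seq c1 c2) s s2 (tr1 ++ tr2)
  | ExecIf o e1 e2 c1 c2 s s' b tr tr' :
      eval_test s o e1 e2 = Some (b, tr) ->
      exec (if b then c1 else c2) s s' tr' ->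
      exec (If o e1 e2 c1 c2) s s' (tr ++ tr')
  | ExecWhileStop o e1 e2 c s tr :
      eval_test s o e1 e2 = Some (false, tr) ->
      exec (While o e1 e2 c) s s tr
  | ExecWhileStep o e1 e2 c s s1 s2 tr tr1 tr2 :
      eval_test s o e1 e2 = Some (true, tr) ->
      exec c s s1 tr1 ->
      exec (While o e1 e2 c) s1 s2 tr2 ->
      exec (While o e1 e2 c) s s2 (tr ++ tr1 ++ tr2).

(* Array contents of a row vector; entries out of range are 0. *)
Definition row_array (R : realType) (n : nat) (v : 'rV[R]_n) (i : nat) : R :=
  if insub i is Some j then v 0 j else 0.

(* Row-major array contents: entry k * L + l is A k l. *)
Definition mx_array (R : realType) (K L : nat) (A : 'M[R]_(K, L)) (i : nat) :
    R :=
  if (insub (i %/ L)%N, insub (i %% L)%N) is (Some k, Some l)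
  then A k l else 0.

(* Memory before the execution; all cells not holding input are 0. *)
Definition input_state (R : realType) (K L : nat) (x mu : 'M[R]_(K, L))
    (y1 y2 : 'rV[R]_K) (t eps : R) : state R :=
  State (nth 0 [:: K%:R; L%:R; t; eps])
        (nth (fun=> 0)
           [:: mx_array x; mx_array mu; row_array y1; row_array y2]).

Definition output (R : realType) (s : state R) : R := var s 0.

(* Main.v *)
Require Import Defs.
From HB Require Import structures.
From mathcomp Require Import all_boot all_order all_algebra.
From mathcomp Require Import all_classical all_reals all_analysis.
From mathcomp Require Import zify ring lra.

Set Implicit Arguments.
Unset Strict Implicit.
Unset Printing Implicit Defensive.

Import Order.TTheory GRing.Theory Num.Theory.
Local Open Scope ring_scope.

(** Only the split of each atom of mu between the two targets is free.  Hence the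
    optimal transport distance is E |X - y2|^2 plus the least value of
    E [g(X) D(X)] over all g with values in [0, 1] and E [g(X)] = t, where
    D(X) = |X - y1|^2 - |X - y2|^2 ([two_point_OT]).  This is a fractional
    knapsack problem, solved greedily by increasing cost.  If D takes natural
    values, the least value is the sum over j of max(0, t - P(D <= j))
    ([selection_min_nat]), so it only depends on the distribution function of D.

    D is a sum of K independent terms, one per coordinate.  Let Dmax bound their
    absolute values and let N be the least number with K Dmax / (N + 1) <= eps.
    If N > 0, the program rounds every term to a multiple of the mesh Dmax / N,
    which changes D by at most K Dmax / (2 N) <= eps; if N = 0, it replaces every
    term by 0, which changes D by at most K Dmax <= eps ([rounding_dist]).  The
    optimal value moves by no more than the cost does ([selection_min_dist]),
    which gives the accuracy ([OT_rounded]).  A rounded term has at most 2 N + 1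
    values, so the distribution of the sum is found by K convolutions of sequences
    of lengths 2 N K + 1 and 2 N + 1.  The minimum for the exact costs is attained
    for the same reason: these are rational, so an affine change turns them into
    natural numbers ([selection_min_exists]).

    Reading the input takes O(K L) operations, the search for N takes O(N), and
    the convolutions take O(K (2 N K + 1) (2 N + 1)).  For N = 0 the latter is
    O(K); for N > 0 it is O(K^2 N^2), hence O(K^2 N^4), and N <= 8 K U^2 / eps
    because all terms of D are at most 8 U^2.  This is the bound
    K^6 U^8 / eps^4 ([ops_le]).

    The tolerance only occurs in comparisons, so all computed numbers are
    rational.  If Gam is a common denominator of the other inputs, every number
    computed without division has a denominator Gam^e with e <= K + 3 and a
    polynomially bounded number of binary digits before the point; such numbers
    are called graded below.  All divisions have graded operands ([transport_prog_sizes]). *)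

(** * Program logic *)

Fixpoint value (R : realType) (s : state R) (e : expr) : R :=
  match e with
  | Const z => z%:~R
  | Var i => var s i
  | Elem a e1 => arr s a (Num.truncn (value s e1))
  | Bin Add e1 e2 => value s e1 + value s e2
  | Bin Defs.Sub e1 e2 => value s e1 - value s e2
  | Bin Mul e1 e2 => value s e1 * value s e2
  | Bin Div e1 e2 => value s e1 / value s e2
  | Round e1 => round_nearest (value s e1)
  end.

Fixpoint esize (e : expr) : nat :=
  match e with
  | Const _ | Var _ => 0
  | Elem _ e1 => esize e1
  | Bin _ e1 e2 => (esize e1 + esize e2).+1
  | Round e1 => (esize e1).+1
  end.

(** Evaluation succeeds and all intermediate results satisfy [G].  With this
    predicate the partial [Defs.eval] can be replaced by the total [value],
    whose rewriting needs no case analysis. *)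
Fixpoint safe (R : realType) (G : R -> Prop) (s : state R) (e : expr) : Prop :=
  match e with
  | Const _ | Var _ => True
  | Elem _ e1 => safe G s e1 /\ value s e1 \is a Num.nat
  | Bin o e1 e2 =>
      [/\ safe G s e1, safe G s e2,
          if o is Div then value s e2 != 0 else True
        & G (value s (Bin o e1 e2))]
  | Round e1 => safe G s e1 /\ G (value s (Round e1))
  end.

Section Logic.
Variables (R : realType) (G : R -> Prop).
Implicit Types (s : state R) (e : expr) (tr : trace R).

Definition all_in tr := forall v, v \in computed_numbers tr -> G v.

Lemma all_in_cat tr1 tr2 : all_in tr1 -> all_in tr2 -> all_in (tr1 ++ tr2).
Proof.
by move=> h1 h2 v; rewrite /computed_numbers pmap_cat mem_cat => /orP[/h1|/h2].
Qed.

Lemma all_in_some v : G v -> all_in [:: Some v].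
Proof. by move=> h u; rewrite inE => /eqP->. Qed.

Lemma eval_safe s e : safe G s e ->
  exists tr, [/\ Defs.eval s e = Some (value s e, tr), size tr = esize e & all_in tr].
Proof.
elim: e => [z|i|a e IH|o e1 IH1 e2 IH2|e IH] /=.
- by exists [::].
- by exists [::].
- by case=> /IH[tr [-> <- ?]] ->; exists tr.
- case=> /IH1[tr1 [-> <- t1]] /IH2[tr2 [-> <- t2]] h g.
  exists (tr1 ++ tr2 ++ [:: Some (value s (Bin o e1 e2))]); split.
  + by case: o h g => //= /negPf->.
  + by rewrite !size_cat /= addn1 addnS.
  + by do 2 apply: all_in_cat => //; apply: all_in_some.
- case=> /IH[tr [-> <- t]] g.
  exists (tr ++ [:: Some (round_nearest (value s e))]); split=> //.
    by rewrite size_cat addn1.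
  by apply: all_in_cat => //; apply: all_in_some.
Qed.

(** Total correctness with resources: [n] bounds the length of the trace, and
    every computed number satisfies [G]. *)
Definition wp (n : nat) (c : cmd) (s : state R) (Q : state R -> Prop) : Prop :=
  exists s' tr, [/\ exec c s s' tr, (size tr <= n)%N, all_in tr & Q s'].

Lemma wp_weak n m c s (Q Q' : state R -> Prop) :
  (n <= m)%N -> (forall s', Q s' -> Q' s') -> wp n c s Q -> wp m c s Q'.
Proof.
move=> nm QQ' [s' [tr [ex sz g q]]]; exists s', tr; split=> //.
- exact: leq_trans nm.
- exact: QQ'.
Qed.

Lemma wp_skip n s (Q : state R -> Prop) : Q s -> wp n Skip s Q.
Proof. by move=> q; exists s, [::]; split=> //; apply: ExecSkip. Qed.

Lemma wp_assign n i e s (Q : state R -> Prop) :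
  (esize e <= n)%N -> safe G s e -> Q (set_var s i (value s e)) ->
  wp n (Assign i e) s Q.
Proof.
move=> en /eval_safe[tr [ev sz g]] q.
exists (set_var s i (value s e)), tr; split=> //; last by rewrite sz.
exact: ExecAssign.
Qed.

Lemma wp_store n a e1 e2 k s (Q : state R -> Prop) :
  (esize e1 + esize e2 <= n)%N -> safe G s e1 -> safe G s e2 ->
  value s e1 = k%:R -> Q (set_arr s a k (value s e2)) ->
  wp n (Store a e1 e2) s Q.
Proof.
move=> en /eval_safe[tr1 [ev1 sz1 g1]] /eval_safe[tr2 [ev2 sz2 g2]] ek q.
exists (set_arr s a k (value s e2)), (tr1 ++ tr2); split=> //.
- by apply: ExecStore => //; rewrite -ek.
- by rewrite size_cat sz1 sz2.
- exact: all_in_cat.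
Qed.

Lemma wp_seq n1 n2 c1 c2 s (Q : state R -> Prop) :
  wp n1 c1 s (fun s1 => wp n2 c2 s1 Q) -> wp (n1 + n2) (Seq c1 c2) s Q.
Proof.
case=> s1 [tr1 [ex1 sz1 g1 [s2 [tr2 [ex2 sz2 g2 q]]]]].
exists s2, (tr1 ++ tr2); split=> //.
- exact: ExecSeq ex1 ex2.
- by rewrite size_cat leq_add.
- exact: all_in_cat.
Qed.

Lemma eval_test_safe s o e1 e2 : safe G s e1 -> safe G s e2 ->
  exists tr, [/\ eval_test s o e1 e2
                   = Some (apply_relop o (value s e1) (value s e2), tr),
                 size tr = (esize e1 + esize e2).+1 & all_in tr].
Proof.
move=> /eval_safe[tr1 [ev1 sz1 g1]] /eval_safe[tr2 [ev2 sz2 g2]].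
exists (tr1 ++ tr2 ++ [:: None]); rewrite /eval_test ev1 ev2; split=> //.
- by rewrite !size_cat sz1 sz2 addn1 addnS.
- by apply: all_in_cat => //; apply: all_in_cat.
Qed.

Lemma wp_if n o e1 e2 c1 c2 s (Q : state R -> Prop) :
  safe G s e1 -> safe G s e2 ->
  (apply_relop o (value s e1) (value s e2) -> wp n c1 s Q) ->
  (~~ apply_relop o (value s e1) (value s e2) -> wp n c2 s Q) ->
  wp ((esize e1 + esize e2).+1 + n) (If o e1 e2 c1 c2) s Q.
Proof.
move=> /eval_test_safe h /h{h} /(_ o)[tr [ev sz g]] w1 w2.
have [s' [tr' [ex sz' g' q]]] :
    wp n (if apply_relop o (value s e1) (value s e2) then c1 else c2) s Q.
  by case: ifPn => [/w1|/w2].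
exists s', (tr ++ tr'); split=> //.
- exact: ExecIf ev ex.
- by rewrite size_cat sz leq_add2l.
- exact: all_in_cat.
Qed.

(** The index [m] of the invariant counts iterations, and the test is only
    required to agree with [m < M].  This covers counting loops as well as a
    search whose number of rounds is characterized mathematically. *)
Lemma wp_while (I : nat -> state R -> Prop) (M n : nat) o e1 e2 c s :
  (forall m s, (m <= M)%N -> I m s ->
     [/\ safe G s e1, safe G s e2
       & apply_relop o (value s e1) (value s e2) = (m < M)%N]) ->
  (forall m s, (m < M)%N -> I m s -> wp n c s (I m.+1)) ->
  I 0%N s ->
  wp (M * (n + (esize e1 + esize e2).+1) + (esize e1 + esize e2).+1)
    (While o e1 e2 c) s (I M).
Proof.
move=> test body; set w := (esize e1 + esize e2).+1.
suff run k m s1 : (k + m = M)%N -> I m s1 ->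
    wp (k * (n + w) + w) (While o e1 e2 c) s1 (I M).
  by apply: run; rewrite addn0.
elim: k m s1 => [|k IH] m s1.
  rewrite add0n => -> i1; have [g1 g2] := test _ _ (leqnn M) i1.
  rewrite ltnn => tst; have [tr [ev sz g]] := eval_test_safe o g1 g2.
  exists s1, tr; split=> //; last by rewrite sz mul0n.
  by apply: ExecWhileStop; rewrite ev tst.
move=> km i1; have ltm : (m < M)%N by rewrite -km addSn ltnS leq_addl.
have [g1 g2] := test _ _ (ltnW ltm) i1; rewrite ltm => tst.
have [tr [ev sz g]] := eval_test_safe o g1 g2; rewrite tst in ev.
have [s2 [tr1 [ex1 sz1 h1 i2]]] := body _ _ ltm i1.
have [|s3 [tr2 [ex2 sz2 h2 i3]]] := IH m.+1 s2 _ i2; first by rewrite addnS.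
exists s3, (tr ++ tr1 ++ tr2); split=> //.
- exact: ExecWhileStep ev ex1 ex2.
- by rewrite !size_cat sz -/w; lia.
- by do 2 apply: all_in_cat => //.
Qed.

End Logic.

Definition For (v b : nat) (c : cmd) : cmd :=
  Seq (Assign v (Const 0))
    (While Lt (Var v) (Var b)
       (Seq c (Assign v (Bin Add (Var v) (Const 1))))).

(** The invariant is taken at the moments when the counter has just been set, so
    that it may speak of the counter. *)
Lemma wp_for (R : realType) (G : R -> Prop) (I : nat -> state R -> Prop)
    (M n v b : nat) c s :
  (forall m s, (m <= M)%N -> I m s -> var s v = m%:R /\ var s b = M%:R) ->
  (forall m, (m <= M)%N -> G m%:R) ->
  (forall m s, (m < M)%N -> I m s ->
     wp G n c s (fun s1 => var s1 v = m%:R /\ I m.+1 (set_var s1 v m.+1%:R))) ->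
  I 0%N (set_var s v 0) ->
  wp G (M * (n + 2) + 1) (For v b c) s (I M).
Proof.
move=> vars gnat body i0; rewrite -[X in wp _ X]add0n /For.
apply: wp_seq; apply: wp_assign => //=.
have -> : (n + 2 = n + 1 + (esize (Var v) + esize (Var b)).+1)%N by rewrite -addnA.
apply: (@wp_while _ _ I M (n + 1)) => //= [m s1 mM i1|m s1 mM i1].
  by have [-> ->] := vars _ _ mM i1; rewrite ltr_nat.
apply: wp_seq; apply: wp_weak (body _ _ mM i1) => // s2 [ev i2].
have e1 : var s2 v + 1%:~R = m.+1%:R by rewrite ev -natr1.
by apply: wp_assign; rewrite /= ?e1 //; split=> //; apply: gnat.
Qed.

(** * Transport to two points *)

Section Selection.
Variables (R : realType) (I : finType) (p : I -> R).
Implicit Types (c g : I -> R) (t v : R) (S : I -> nat).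

Definition selection (t : R) (g : I -> R) : Prop :=
  (forall i, 0 <= g i <= p i) /\ \sum_i g i = t.

(** [v] is the minimum of a fractional knapsack problem that must be filled up to
    exactly [t]. *)
Definition selection_min (c : I -> R) (t v : R) : Prop :=
  (exists2 g, selection t g & v = \sum_i g i * c i) /\
  (forall g, selection t g -> v <= \sum_i g i * c i).

Lemma selection_min_affine c c' a b t v :
  0 <= b -> (forall i, c' i = a + b * c i) ->
  selection_min c t v -> selection_min c' t (a * t + b * v).
Proof.
move=> b0 c'E [[g sg vE] lb].
have costE g' : selection t g' ->
    \sum_i g' i * c' i = a * t + b * \sum_i g' i * c i.
  move=> [_ <-]; rewrite !mulr_sumr -big_split; apply: eq_bigr => i _.
  by rewrite c'E /=; ring.
split; first by exists g; rewrite // costE // vE.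
by move=> g' sg'; rewrite costE // lerD2l ler_wpM2l // lb.
Qed.

Lemma selection_min_le c c' e t v v' :
  0 <= e -> t <= 1 -> (forall i, c' i <= c i + e) ->
  selection_min c t v -> selection_min c' t v' -> v' <= v + e.
Proof.
move=> e0 t1 cc' [[g sg ->] _] [_ lb]; apply: le_trans (lb _ sg) _.
have [g01 gt] := sg.
apply: (@le_trans _ _ (\sum_i (g i * c i + g i * e))).
  apply: ler_sum => i _; rewrite -mulrDr ler_wpM2l //.
  by case/andP: (g01 i).
by rewrite big_split /= -mulr_suml gt lerD2l ler_piMl.
Qed.

(** A selection has total mass at most 1, so its cost, and hence the minimum, is a
    1-Lipschitz function of the costs in the maximum norm. *)
Lemma selection_min_dist c c' e t v v' :
  0 <= e -> t <= 1 -> (forall i, `|c i - c' i| <= e) ->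
  selection_min c t v -> selection_min c' t v' -> `|v - v'| <= e.
Proof.
move=> e0 t1 cc' mv mv'; have {}cc' i : c' i <= c i + e /\ c i <= c' i + e.
  by have := cc' i; rewrite ler_norml; lra.
have h1 : v' <= v + e.
  by apply: selection_min_le mv mv' => // i; have [] := cc' i.
have h2 : v <= v' + e.
  by apply: selection_min_le mv' mv => // i; have [] := cc' i.
by rewrite ler_norml; lra.
Qed.

Lemma layer_cake S M g : (forall i, (S i < M)%N) ->
  \sum_i g i * (S i)%:R
    = \sum_(j < M) (\sum_i g i - \sum_(i | (S i <= j)%N) g i).
Proof.
move=> SM.
transitivity (\sum_i \sum_(j < M) (if (j < S i)%N then g i else 0)).
  apply: eq_bigr => i _; rewrite -big_mkcond /=.
  by rewrite -(big_ord_widen _ (fun=> g i) (ltnW (SM i))) sumr_const card_ord mulr_natr.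
rewrite exchange_big; apply: eq_bigr => j _ /=.
rewrite [X in X - _](bigID (fun i => (S i <= j)%N)) /= addrAC subrr add0r.
by rewrite [RHS]big_mkcond; apply: eq_bigr => i _; rewrite ltnNge.
Qed.

(** The optimal selection spends the budget [t] greedily by increasing cost;
    by the layer-cake formula, the cost of a selection is the sum over [j] of
    its mass on costs above [j], which is at least the part of [t] that
    exceeds the available mass of costs up to [j]. *)
Lemma selection_min_nat S M t :
  (forall i, 0 <= p i) -> \sum_i p i = 1 -> 0 <= t <= 1 ->
  (forall i, (S i < M)%N) ->
  selection_min (fun i => (S i)%:R) t
    (\sum_(j < M) Num.max 0 (t - \sum_(i | (S i <= j)%N) p i)).
Proof.
move=> p0 p1 /andP[t0 t1] SM; split; last first.
  move=> g [g01 gt]; rewrite (layer_cake _ SM); apply: ler_sum => j _.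
  have lep (P : pred I) : \sum_(i | P i) g i <= \sum_(i | P i) p i.
    by apply: ler_sum => i _; case/andP: (g01 i).
  rewrite ge_max gt lerB ?lep // andbT subr_ge0 -gt.
  rewrite [X in _ <= X](bigID (fun i => (S i <= j)%N)) /=.
  by rewrite lerDl sumr_ge0 // => i _; case/andP: (g01 i).
(* [rem n] is the budget left when all costs below [n] have been served; the
   class of cost [n] receives the decrease of [rem], spread proportionally. *)
pose F n := \sum_(i | (S i < n)%N) p i.
pose rem n := Num.max 0 (t - F n).
pose q n := \sum_(i | S i == n) p i.
have FS n : F n.+1 = F n + q n.
  rewrite /F (bigID (fun i => (S i < n)%N)) /=; congr (_ + _).
    by apply: eq_bigl => i; rewrite ltnS andbC; case: ltnP => // /ltnW ->.
  by apply: eq_bigl => i; rewrite ltnS -leqNgt eqn_leq.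
have q0 n : 0 <= q n by apply: sumr_ge0.
have remS n : 0 <= rem n - rem n.+1 <= q n.
  have := q0 n; rewrite /rem FS.
  by case: (lerP 0 (t - F n)); case: (lerP 0 (t - (F n + q n))); lra.
have F0 : F 0%N = 0 by rewrite /F big_pred0.
have rem0 : rem 0%N = t by rewrite /rem F0 subr0 max_r.
pose w n := (rem n - rem n.+1) / q n.
have wq n : q n * w n = rem n - rem n.+1.
  rewrite /w; case: (eqVneq (q n) 0) => [qn|qn]; last by field.
  by have := remS n; rewrite qn; lra.
have w01 n : 0 <= w n <= 1.
  have /andP[r0 rq] := remS n; rewrite /w divr_ge0 //=.
  case: (eqVneq (q n) 0) => [->|qn]; first by rewrite invr0 mulr0.
  by rewrite ler_pdivrMr ?mul1r // lt0r qn q0.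
pose g i := p i * w (S i).
have sumq n : \sum_(i | S i == n) g i = rem n - rem n.+1.
  by rewrite -wq /q mulr_suml; apply: eq_bigr => i /eqP <-.
have sumg n : \sum_(i | (S i < n)%N) g i = t - rem n.
  elim: n => [|n IH]; first by rewrite big_pred0 // rem0 subrr.
  rewrite (bigID (fun i => (S i < n)%N)) /=.
  have -> : t - rem n.+1 = (t - rem n) + (rem n - rem n.+1) by ring.
  rewrite -IH -sumq; congr (_ + _).
    by apply: eq_bigl => i; rewrite ltnS andbC; case: ltnP => // /ltnW ->.
  by apply: eq_bigl => i; rewrite ltnS -leqNgt eqn_leq.
have FM : F M = 1 by rewrite /F -p1; apply: eq_bigl => i; rewrite SM.
have remM : rem M = 0 by rewrite /rem FM max_l // subr_le0.
have gt : \sum_i g i = t.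
  transitivity (\sum_(i | (S i < M)%N) g i); last by rewrite sumg remM subr0.
  by apply: eq_bigl => i; rewrite SM.
exists g; first split=> // i.
  have /andP[w0 w1] := w01 (S i).
  by rewrite mulr_ge0 ?p0 //= -[X in _ <= X]mulr1 ler_wpM2l.
rewrite (layer_cake _ SM); apply: eq_bigr => j _.
by rewrite gt (sumg j.+1) subKr.
Qed.

End Selection.

(** Transport to two points only has to decide which part of every atom goes
    to the first point. *)
Lemma two_point_OT (R : realType) (K : nat) (c : 'rV[R]_K -> 'rV[R]_K -> R)
    (m : ddistr R 'rV[R]_K) (t v : R) (y1 y2 : 'rV[R]_K) :
  \sum_i wt (d := m) i = 1 ->
  selection_min (@wt _ _ m) (fun i => c (pt i) y1 - c (pt i) y2) t v ->
  is_OT_distance c m (two_point_distr t y1 y2)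
    (\sum_i wt (d := m) i * c (pt i) y2 + v).
Proof.
move=> m1 [[g [g01 gt] vE] lb].
have costE (pi : idx m -> bool -> R) : (forall i, \sum_j pi i j = wt i) ->
    @transport_cost _ _ c m (two_point_distr t y1 y2) pi
    = \sum_i wt (d := m) i * c (pt i) y2
      + \sum_i pi i true * (c (pt i) y1 - c (pt i) y2).
  move=> marg; rewrite /transport_cost. rewrite -big_split; apply: eq_bigr => i _ /=.
  by rewrite -marg !big_bool /=; ring.
split.
  exists (fun i (b : bool) => if b then g i else wt i - g i).
    split=> [i [] /=|i|[] /=].
    - by case/andP: (g01 i).
    - by rewrite subr_ge0; case/andP: (g01 i).
    - by rewrite big_bool /=; ring.
    - exact: gt.
    - by rewrite sumrB gt m1.
  by rewrite costE ?vE // => i; rewrite big_bool /=; ring.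
move=> pi [pi0 rows cols]; rewrite costE // lerD2l; apply: lb; split.
  move=> i; rewrite pi0 /=; have := rows i; rewrite big_bool /=.
  by have := pi0 i false; lra.
exact: (cols true).
Qed.

(** Costs with a common denominator become natural numbers after scaling and
    shifting, so the explicit minimum for natural costs gives existence. *)
Lemma selection_min_exists (R : realType) (I : finType) (p c : I -> R)
    (t : R) (b : nat) :
  (forall i, 0 <= p i) -> \sum_i p i = 1 -> 0 <= t <= 1 -> (0 < b)%N ->
  (forall i, c i * b%:R \is a Num.int) -> exists v, selection_min p c t v.
Proof.
move=> p0 p1 t01 b0 cb.
pose z i := Num.floor (c i * b%:R).
have zE i : (z i)%:~R = c i * b%:R by apply: floorK.
(* A shift that makes all scaled costs nonnegative. *)
pose a := (\sum_i `|z i|)%N.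
pose S i := `|(z i + a%:Z)%R|%N.
have SE i : (S i)%:R = c i * b%:R + a%:R.
  have za : 0 <= z i + a%:Z.
    have : (`|z i| <= a)%N by rewrite /a (bigD1 i) //= leq_addr.
    by lia.
  by rewrite /S pmulrn gez0_abs // intrD zE -pmulrn.
have SM i : (S i < (\sum_i S i).+1)%N by rewrite ltnS (bigD1 i) //= leq_addr.
have m := selection_min_nat p0 p1 t01 SM.
eexists; apply: selection_min_affine m => [|i]; last first.
  rewrite (_ : c i = - a%:R / b%:R + b%:R^-1 * (S i)%:R) // SE.
  by field; rewrite pnatr_eq0 -lt0n.
by rewrite invr_ge0.
Qed.

(** * Product distributions *)

Section Product.
Variables (R : realType) (K L : nat) (mu : 'M[R]_(K, L)).
Hypothesis mu0 : forall k l, 0 <= mu k l.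
Hypothesis mu1 : forall k, \sum_l mu k l = 1.
Implicit Types f : {ffun 'I_K -> 'I_L}.

Definition prodw f : R := \prod_k mu k (f k).

Lemma prodw_ge0 f : 0 <= prodw f.
Proof. by apply: prodr_ge0. Qed.

Lemma sum_prodw : \sum_f prodw f = 1.
Proof.
by rewrite -(bigA_distr_bigA (fun k l => mu k l)) big1.
Qed.

(** Linearity of expectation: the expectation of a sum of functions of single
    coordinates only involves the marginals. *)
Lemma sum_prodw_add (e : 'I_K -> 'I_L -> R) :
  \sum_f prodw f * \sum_k e k (f k) = \sum_k \sum_l mu k l * e k l.
Proof.
under eq_bigr do rewrite mulr_sumr.
rewrite exchange_big; apply: eq_bigr => k _ /=.
(* A factor [e k (f k)] is absorbed into the k-th marginal, so that the
   generalized distributive law applies. *)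
pose m k' l := mu k' l * (if k' == k then e k l else 1).
transitivity (\sum_(f : {ffun 'I_K -> 'I_L}) \prod_k' m k' (f k')).
  apply: eq_bigr => f _; rewrite big_split; congr (_ * _) => /=.
  by rewrite -big_mkcond big_pred1_eq.
rewrite -(bigA_distr_bigA m) (bigD1 k) //= [X in _ * X]big1 ?mulr1.
  by apply: eq_bigr => l _; rewrite /m eqxx.
by move=> j /negPf jk; rewrite -[RHS](mu1 j); apply: eq_bigr => l _; rewrite /m jk mulr1.
Qed.

(** The generating polynomial of a sum of independent natural numbers is the
    product of the generating polynomials of its terms. *)
Lemma prodw_cdf (s : 'I_K -> 'I_L -> nat) (j : nat) :
  \sum_(f : {ffun 'I_K -> 'I_L} | (\sum_k s k (f k) <= j)%N) prodw f
    = \sum_(i < j.+1) (\prod_k \sum_l mu k l *: 'X^(s k l))`_i.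
Proof.
rewrite (bigA_distr_bigA (fun k l => mu k l *: 'X^(s k l))).
have genE f : \prod_k (mu k (f k) *: 'X^(s k (f k)))
    = prodw f *: 'X^(\sum_k s k (f k)) :> {poly R}.
  by rewrite scaler_prod prodrXr.
under [RHS]eq_bigr do rewrite coef_sum.
rewrite exchange_big big_mkcond; apply: eq_bigr => f _ /=.
rewrite (eq_bigr (fun i : 'I_j.+1 =>
    prodw f * (i == (\sum_k s k (f k))%N :> nat)%:R)); last first.
  by move=> i _; rewrite -coefXn -coefZ -genE.
rewrite -mulr_sumr; case: leqP => sj.
  rewrite (bigD1 (Ordinal (sj : (\sum_k s k (f k) < j.+1)%N))) //= eqxx big1 ?addr0 ?mulr1 //.
  by move=> i ne; rewrite -(inj_eq val_inj) /= in ne; rewrite (negPf ne).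
rewrite big1 ?mulr0 // => i _; case: eqP => // e.
by have := ltn_ord i; rewrite ltnS e leqNgt sj.
Qed.

End Product.

Lemma sq_dist_sum (R : realType) (K : nat) (u v : 'rV[R]_K) :
  sq_dist u v = \sum_k (u 0 k - v 0 k) ^+ 2.
Proof.
rewrite /sq_dist /enorm sqr_sqrtr; last by apply: sumr_ge0 => k _; apply: sqr_ge0.
by apply: eq_bigr => k _; rewrite !mxE.
Qed.

(** Replacing the costs [d] by [h * (s - N)] moves the optimal value by at most
    the largest change of a total cost; the value for the new costs only
    depends on the distribution function of the sum of the [s k]. *)
Lemma OT_rounded (R : realType) (K L N b : nat) (x mu : 'M[R]_(K, L))
    (y1 y2 : 'rV[R]_K) (t h eps : R) (s : 'I_K -> 'I_L -> nat) :
  let d k l := (x k l - y1 0 k) ^+ 2 - (x k l - y2 0 k) ^+ 2 in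
  (forall k l, 0 <= mu k l) -> (forall k, \sum_l mu k l = 1) ->
  0 <= t <= 1 -> 0 <= h -> 0 <= eps -> (0 < b)%N ->
  (forall k l, d k l * b%:R \is a Num.int) ->
  (forall k l, s k l <= 2 * N)%N ->
  (forall f : {ffun 'I_K -> 'I_L},
     `|h * \sum_k ((s k (f k))%:R - N%:R) - \sum_k d k (f k)| <= eps) ->
  exists2 W : R,
    is_OT_distance (@sq_dist R K)
      (product_distr x mu) (two_point_distr t y1 y2) W
    & `|\sum_k \sum_l mu k l * (x k l - y2 0 k) ^+ 2
        + h * (\sum_(j < (2 * N * K).+1)
                 Num.max 0 (t - \sum_(i < j.+1)
                   (\prod_k \sum_l mu k l *: 'X^(s k l))`_i)
               - t * (N * K)%:R) - W| <= eps.
Proof.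
move=> d mu0 mu1 t01 h0 eps0 b0 db sN dist.
have p0 := prodw_ge0 mu0; have p1 := sum_prodw mu1.
pose D (f : {ffun 'I_K -> 'I_L}) := \sum_k d k (f k).
pose S (f : {ffun 'I_K -> 'I_L}) := (\sum_k s k (f k))%N.
have [|v mv] := @selection_min_exists R _ (prodw mu) D t b p0 p1 t01 b0.
  by move=> f; rewrite mulr_suml; apply: rpred_sum => k _; apply: db.
have SM f : (S f < (2 * N * K).+1)%N.
  rewrite ltnS; apply: leq_trans (_ : \sum_(k < K) 2 * N <= _)%N.
    by apply: leq_sum => k _; apply: sN.
  by rewrite sum_nat_const card_ord mulnC.
have ms := selection_min_nat p0 p1 t01 SM.
have {}ms : selection_min (prodw mu)
    (fun f => h * \sum_k ((s k (f k))%:R - N%:R)) t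
    (- h * (N * K)%:R * t + h * (\sum_(j < (2 * N * K).+1)
       Num.max 0 (t - \sum_(f | (S f <= j)%N) prodw mu f))).
  apply: selection_min_affine ms => // f.
  by rewrite sumrB sumr_const card_ord /S natr_sum natrM mulr_natr; ring.
have dE (f : {ffun 'I_K -> 'I_L}) :
    sq_dist (\row_k x k (f k)) y1 - sq_dist (\row_k x k (f k)) y2 = D f.
  by rewrite !sq_dist_sum -sumrB; apply: eq_bigr => k _; rewrite !mxE.
have E2 : \sum_f prodw mu f * sq_dist (\row_k x k (f k)) y2
    = \sum_k \sum_l mu k l * (x k l - y2 0 k) ^+ 2.
  rewrite -(sum_prodw_add mu1 (fun k l => (x k l - y2 0 k) ^+ 2)).
  apply: eq_bigr => f _; rewrite sq_dist_sum; congr (_ * _).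
  by apply: eq_bigr => k _; rewrite !mxE.
exists (\sum_k \sum_l mu k l * (x k l - y2 0 k) ^+ 2 + v).
  rewrite -E2; apply: (@two_point_OT _ _ _ (product_distr x mu)) => //=.
  suff <- : D = (fun f => sq_dist (\row_k x k (f k)) y1
                          - sq_dist (\row_k x k (f k)) y2) by [].
  by apply/boolp.funext => f; rewrite dE.
rewrite opprD addrACA subrr add0r.
have t1 : t <= 1 by case/andP: t01.
apply: (selection_min_dist eps0 t1 dist) mv.
suff -> : h * (\sum_(j < (2 * N * K).+1)
      Num.max 0 (t - \sum_(i < j.+1) (\prod_k \sum_l mu k l *: 'X^(s k l))`_i)
      - t * (N * K)%:R)
    = - h * (N * K)%:R * t + h * (\sum_(j < (2 * N * K).+1)
      Num.max 0 (t - \sum_(f | (S f <= j)%N) prodw mu f)) by exact: ms.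
rewrite mulrBr addrC; congr (_ + h * _); first by ring.
by apply: eq_bigr => j _; rewrite prodw_cdf.
Qed.

(** * Sizes of numbers *)

Section Sizes.
Variable R : realType.
Implicit Types (u v : R) (e b n m : nat).

Lemma nat_bits_le n m : (n <= 2 ^ m)%N -> (nat_bits n <= m.+1)%N.
Proof.
by move=> nm; rewrite /nat_bits ltnS -[leqRHS](@trunc_expnK 2) // leq_trunc_log.
Qed.

Lemma is_fraction_bits m v : is_fraction (2 ^ m) v ->
  exists2 q : rat, v = ratr q & (rat_bits q <= 2 * m + 3)%N.
Proof.
case=> p [r [r0 pm rm ->]]; exists (p%:Q / r%:Q).
  by rewrite rmorph_div /= ?ratr_int // unitfE intr_eq0.
case: divqP r0 pm rm => [k|k x k0]; first by rewrite eqxx.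
move=> _ pm rm; rewrite /rat_bits.
have hn : (`|numq x| <= 2 ^ m)%N.
  move: pm; rewrite -abszE lez_nat abszM; apply: leq_trans.
  by rewrite leq_pmull // absz_gt0.
have hd : (`|denq x| <= 2 ^ m)%N.
  move: rm; rewrite -abszE lez_nat abszM; apply: leq_trans.
  by rewrite leq_pmull // absz_gt0.
by have := nat_bits_le hn; have := nat_bits_le hd; lia.
Qed.

(** A nonzero integer denominator has absolute value at least 1. *)
Lemma is_fraction_norm U v : is_fraction U v -> `|v| <= U%:R.
Proof.
case=> p [r [r0 pU rU ->]]; rewrite normrM normfV -!intr_norm.
rewrite ler_pdivrMr ?ltr0z ?normr_gt0 //.
apply: le_trans (_ : U%:R <= _); first by rewrite -[U%:R]/(U%:Z%:~R) ler_int.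
by rewrite ler_peMr // -[1]/(1%:~R) ler_int -gtz0_ge1 normr_gt0.
Qed.

Lemma common_denominator U (s : seq R) : (forall v, v \in s -> is_fraction U v) ->
  exists g : nat, [/\ (0 < g)%N, (g <= U ^ size s)%N
    & forall v, v \in s -> v * g%:R \is a Num.int].
Proof.
elim: s => [|a s IH] fr; first by exists 1%N.
have [|g [g0 gU gs]] := IH; first by move=> v vs; apply: fr; rewrite inE vs orbT.
have [p [r [r0 pU rU aE]]] := fr a (mem_head _ _).
exists (`|r| * g)%N; split.
- by rewrite muln_gt0 absz_gt0 r0.
- by rewrite expnS leq_mul // -lez_nat abszE.
have rr : (`|r|%N)%:R = `|r|%:~R :> R by rewrite -abszE.
move=> v; rewrite inE natrM => /orP[/eqP->|/gs vg].
  rewrite mulrA rpredM ?rpred_nat // rr aE.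
  have rn : r%:~R != 0 :> R by rewrite intr_eq0.
  have [sr|sr] := lerP 0 r; first by rewrite ger0_norm // mulfVK ?intr_int.
  by rewrite ltr0_norm // rmorphN /= mulrN mulfVK // rpredN intr_int.
by rewrite mulrCA rpredM // rpred_nat.
Qed.

Variable (Gam g : nat).
Hypothesis Gam0 : (0 < Gam)%N.
Hypothesis Gamg : (Gam <= 2 ^ g)%N.

(** Two additive exponents describe a size: that of the common denominator and
    that of 2 in a bound of the absolute value.  Sums do not change the first, so
    even sums of exponentially many terms keep small denominators. *)
Definition graded e b v := v * Gam%:R ^+ e \is a Num.int /\ `|v| <= 2 ^+ b.

Lemma graded_weak e e' b b' v : (e <= e')%N -> (b <= b')%N ->
  graded e b v -> graded e' b' v.
Proof.
move=> ee bb [vi vb]; split.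
  by rewrite -(subnKC ee) exprD mulrA rpredM // rpredX // rpred_nat.
by apply: le_trans vb _; rewrite ler_weXn2l // ler1n.
Qed.

Lemma graded_nat n b : (n <= 2 ^ b)%N -> graded 0 b n%:R.
Proof.
by move=> nb; split; [rewrite mulr1 rpred_nat|rewrite normr_nat -natrX ler_nat].
Qed.

Lemma graded0 e b : graded e b 0.
Proof. by apply: (@graded_weak 0 _ 0) => //; apply: (graded_nat (n := 0)). Qed.

Lemma gradedN e b v : graded e b v -> graded e b (- v).
Proof. by case=> vi vb; split; rewrite ?normrN // mulNr rpredN. Qed.

Lemma gradedD e b u v : graded e b u -> graded e b v -> graded e b.+1 (u + v).
Proof.
move=> [ui ub] [vi vb]; split; first by rewrite mulrDl rpredD.
by apply: le_trans (ler_normD _ _) _; rewrite exprS mulr_natl lerD.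
Qed.

Lemma gradedB e b u v : graded e b u -> graded e b v -> graded e b.+1 (u - v).
Proof. by move=> ? ?; apply: gradedD => //; apply: gradedN. Qed.

Lemma gradedM e e' b b' u v : graded e b u -> graded e' b' v ->
  graded (e + e') (b + b') (u * v).
Proof.
move=> [ui ub] [vi vb]; split; first by rewrite exprD mulrACA rpredM.
by rewrite normrM exprD ler_pM.
Qed.

Lemma graded_max0 e b v : graded e b v -> graded e b (Num.max 0 v).
Proof. by move=> gv; case: leP => // _; apply: graded0. Qed.

Lemma graded_sum e b c n (F : nat -> R) : (n <= 2 ^ c)%N ->
  (forall i, (i < n)%N -> graded e b (F i)) ->
  graded e (b + c) (\sum_(i < n) F i).
Proof.
move=> nc gF; split.
  by rewrite mulr_suml rpred_sum // => i _; case: (gF i).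
apply: le_trans (ler_norm_sum _ _ _) _.
apply: le_trans (_ : \sum_(i < n) 2 ^+ b <= _).
  by apply: ler_sum => i _; case: (gF i).
by rewrite sumr_const card_ord exprD -[X in X <= _]mulr_natr ler_wpM2l // -natrX ler_nat.
Qed.

(** After scaling both operands by [Gam ^+ e], the quotient is one of integers; it
    need not be graded itself. *)
Lemma graded_div e b m u v : graded e b u -> graded e b v -> v != 0 ->
  (b + g * e <= m)%N -> is_fraction (2 ^ m) (u / v).
Proof.
move=> [ui ub] [vi vb] v0 bm.
have Ge0 : Gam%:R ^+ e != 0 :> R by rewrite expf_neq0 // pnatr_eq0 -lt0n.
have bnd (w : R) : w * Gam%:R ^+ e \is a Num.int -> `|w| <= 2 ^+ b ->
    `|Num.floor (w * Gam%:R ^+ e)| <= (2 ^ m)%N%:Z.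
move=> wi wb; rewrite -(ler_int R) intr_norm floorK // normrM normrX normr_nat.
  apply: le_trans (_ : 2 ^+ (b + g * e) <= _).
    rewrite exprD exprM; apply: ler_pM; rewrite ?exprn_ge0 //.
    by rewrite lerXn2r // ?nnegrE ?exprn_ge0 // -natrX ler_nat.
  by rewrite -[X in _ <= X]/((2 ^ m)%N%:R) natrX ler_weXn2l // ler1n.
exists (Num.floor (u * Gam%:R ^+ e)), (Num.floor (v * Gam%:R ^+ e)); split.
- by rewrite -(intr_eq0 R) floorK // mulf_neq0.
- exact: bnd.
- exact: bnd.
- by rewrite !floorK // -mulf_div divff // mulr1.
Qed.

Lemma graded_fraction e b m v : graded e b v ->
  (b + g * e <= m)%N -> is_fraction (2 ^ m) v.
Proof.
move=> gv bm; rewrite -[v]divr1; apply: graded_div gv _ (oner_neq0 _) bm.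
by apply: (@graded_weak 0 _ 0) => //; apply: (graded_nat (n := 1)).
Qed.

End Sizes.

(** * The algorithm *)

Local Notation "e1 '[+]' e2" := (Bin Add e1 e2) (at level 50, left associativity).
Local Notation "e1 '[-]' e2" := (Bin Defs.Sub e1 e2) (at level 50, left associativity).
Local Notation "e1 '[*]' e2" := (Bin Mul e1 e2) (at level 40, left associativity).
Local Notation "e1 '[/]' e2" := (Bin Div e1 e2) (at level 40, left associativity).
Local Notation "i '::=' e" := (Assign i e) (at level 70).
Local Notation "c1 ';;' c2" := (Seq c1 c2) (at level 80, right associativity).

Local Notation vK := 0%N.
Local Notation vL := 1%N.
Local Notation vt := 2%N.
Local Notation veps := 3%N.
Local Notation vk := 4%N.
Local Notation vl := 5%N.
Local Notation vd := 6%N.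
Local Notation vD := 7%N.
Local Notation vE := 8%N.
Local Notation vN := 9%N.
Local Notation vq := 10%N.
Local Notation vh := 11%N.
Local Notation vi := 12%N.
Local Notation vj := 13%N.
Local Notation vF := 14%N.
Local Notation vA := 15%N.
Local Notation vW := 16%N.
Local Notation vB := 17%N.
Local Notation aX := 0%N.
Local Notation aM := 1%N.
Local Notation aY1 := 2%N.
Local Notation aY2 := 3%N.
Local Notation aQ := 4%N.
Local Notation aP := 5%N.

(** The index of entry (k, l) of a matrix in row-major order.  This expression and
    the next are locked, lest rewriting with [valueE] should expand them. *)
HB.lock Definition cell : expr := Var vk [*] Var vL [+] Var vl.

HB.lock Definition sqdev (a : nat) : expr :=
  (Elem aX cell [-] Elem a (Var vk)) [*] (Elem aX cell [-] Elem a (Var vk)).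

(** The variable [vE] accumulates E |X - y2|^2, and [vD] the largest absolute
    value of a term of D. *)
Definition moments : cmd :=
  For vk vK (For vl vL (
    vE ::= Var vE [+] Elem aM cell [*] sqdev aY2 ;;
    vd ::= sqdev aY1 [-] sqdev aY2 ;;
    If Lt (Var vD) (Var vd) (vD ::= Var vd) Skip ;;
    If Lt (Var vD) (Const 0 [-] Var vd) (vD ::= Const 0 [-] Var vd) Skip)).

(** [vN] becomes the number of mesh steps; a resolution 0 leaves the factors [vq]
    and [vh] at 0, which makes all rounded costs vanish.  The tolerance is read
    in the test only and never enters an arithmetic operation, so that all
    computed numbers are rational. *)
Definition resolution : cmd :=
  While Lt (Var veps) ((Var vK [*] Var vD) [/] (Var vN [+] Const 1))
    (vN ::= Var vN [+] Const 1) ;;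
  If Lt (Const 0) (Var vN)
    (vq ::= Var vN [/] Var vD ;; vh ::= Var vD [/] Var vN) Skip ;;
  vB ::= Const 2 [*] Var vN [+] Const 1 ;;
  vW ::= Const 2 [*] Var vN [*] Var vK [+] Const 1.

(** Terms that round to the same value are merged before the convolution, so that
    its cost depends on the resolution and not on L.  Adding [vN] shifts the
    rounded values to array indices. *)
Definition bucketing : cmd :=
  For vl vL (
    vd ::= Round ((sqdev aY1 [-] sqdev aY2) [*] Var vq) [+] Var vN ;;
    Store aQ (Var vk [*] Var vB [+] Var vd)
      (Elem aQ (Var vk [*] Var vB [+] Var vd) [+] Elem aM cell)).

(** Row k + 1 of the array [aP] is the distribution of the sum of the first k + 1
    rounded and shifted terms.  A fresh row per step avoids clearing cells. *)
Definition convolution : cmd :=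
  For vi vW (
    vA ::= Const 0 ;;
    For vj vB (
      If Le (Var vj) (Var vi)
        (vA ::= Var vA [+] Elem aP (Var vk [*] Var vW [+] (Var vi [-] Var vj))
                       [*] Elem aQ (Var vk [*] Var vB [+] Var vj))
        Skip) ;;
    Store aP ((Var vk [+] Const 1) [*] Var vW [+] Var vi) (Var vA)).

(** The sum over j of max(0, t - P(S <= j)), for S the sum of the rounded and
    shifted terms. *)
Definition greedy : cmd :=
  vA ::= Const 0 ;;
  For vi vW (
    vF ::= Var vF [+] Elem aP (Var vK [*] Var vW [+] Var vi) ;;
    If Lt (Var vF) (Var vt) (vA ::= Var vA [+] (Var vt [-] Var vF)) Skip).

Definition transport_prog : cmd :=
  moments ;; resolution ;;
  Store aP (Const 0) (Const 1) ;;
  For vk vK (bucketing ;; convolution) ;;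
  greedy ;;
  vK ::= Var vE [+] Var vh [*] (Var vA [-] Var vt [*] (Var vN [*] Var vK)).

Section Values.
Variables (R : realType) (s : state R).
Implicit Types e : expr.

Lemma value_const n : value s (Const (Posz n)) = n%:R. Proof. by []. Qed.
Lemma value_var i : value s (Var i) = var s i. Proof. by []. Qed.
Lemma valueD e1 e2 : value s (e1 [+] e2) = value s e1 + value s e2.
Proof. by []. Qed.
Lemma valueB e1 e2 : value s (e1 [-] e2) = value s e1 - value s e2.
Proof. by []. Qed.
Lemma valueM e1 e2 : value s (e1 [*] e2) = value s e1 * value s e2.
Proof. by []. Qed.
Lemma valueV e1 e2 : value s (e1 [/] e2) = value s e1 / value s e2.
Proof. by []. Qed.
Lemma value_round e : value s (Round e) = round_nearest (value s e).
Proof. by []. Qed.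

Definition valueE :=
  (value_const, value_var, valueD, valueB, valueM, valueV, value_round).
End Values.

Lemma round_nearest_dist (R : realType) (v : R) : `|round_nearest v - v| <= 2^-1.
Proof.
rewrite ler_norml /round_nearest; have /andP[] := floor_itv (v + 2^-1).
by rewrite intrD; lra.
Qed.

Lemma round_nearest_le (R : realType) (v : R) n : `|v| <= n%:R -> `|round_nearest v| <= n%:R.
Proof.
rewrite !ler_norml /round_nearest => /andP[h1 h2].
have /andP[f1 f2] := floor_itv (v + 2^-1).
have e : n%:R = n%:Z%:~R :> R by [].
move: h1 h2; rewrite e -rmorphN /= !ler_int => h1 h2.
rewrite intrD in f2; apply/andP; split.
  by rewrite -ltzD1 -(ltr_int R) intrD; lra.
by rewrite -ltzD1 -(ltr_int R) intrD; lra.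
Qed.

(** This keeps the rows of a table stored in one array apart. *)
Lemma stride_inj w a b j i : (j < w)%N -> (i < w)%N ->
  (a * w + j == b * w + i)%N = (a == b) && (j == i).
Proof.
move=> jw iw; apply/eqP/andP => [e|[/eqP-> /eqP->] //].
have w0 : (0 < w)%N by lia.
have ab : a = b.
  by have /(congr1 (divn^~ w)) := e; rewrite !divnMDl // !divn_small // !addn0.
by split; apply/eqP => //; move: e; rewrite ab => /addnI.
Qed.

Section Verification.
Variables (R : realType) (G : R -> Prop) (K L : nat).
Variables (X M Y1 Y2 : nat -> R) (t eps : R) (NB : nat).
Hypothesis Gnat : forall n, (n <= NB)%N -> G n%:R.
Hypothesis NB_inputs : (K * L + K + L <= NB)%N.

Record inputs (s : state R) : Prop := Inputs {
  input_K : var s vK = K%:R;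
  input_L : var s vL = L%:R;
  input_t : var s vt = t;
  input_eps : var s veps = eps;
  input_X : forall n, arr s aX n = X n;
  input_M : forall n, arr s aM n = M n;
  input_Y1 : forall n, arr s aY1 n = Y1 n;
  input_Y2 : forall n, arr s aY2 n = Y2 n }.

Definition dev (Y : nat -> R) k l := X (k * L + l)%N - Y k.
Definition dif k l := dev Y1 k l * dev Y1 k l - dev Y2 k l * dev Y2 k l.
Definition moment_term k l := M (k * L + l)%N * (dev Y2 k l * dev Y2 k l).
(** The value of [vE] when the loops have reached entry (k, l). *)
Definition moment k l :=
  \sum_(i < k) \sum_(j < L) moment_term i j + \sum_(j < l) moment_term k j.

Hypothesis GdevY1 : forall k l, (k < K)%N -> (l < L)%N -> G (dev Y1 k l).
Hypothesis GdevY2 : forall k l, (k < K)%N -> (l < L)%N -> G (dev Y2 k l).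
Hypothesis GsqY1 :
  forall k l, (k < K)%N -> (l < L)%N -> G (dev Y1 k l * dev Y1 k l).
Hypothesis GsqY2 :
  forall k l, (k < K)%N -> (l < L)%N -> G (dev Y2 k l * dev Y2 k l).
Hypothesis Gdif : forall k l, (k < K)%N -> (l < L)%N -> G (dif k l).
Hypothesis Gndif : forall k l, (k < K)%N -> (l < L)%N -> G (0 - dif k l).
Hypothesis Gterm : forall k l, (k < K)%N -> (l < L)%N -> G (moment_term k l).
Hypothesis Gmoment : forall k l, (k < K)%N -> (l <= L)%N -> G (moment k l).

(** The situation inside a loop over [vk] and [vl], in which the expressions
    [cell] and [sqdev] can be evaluated. *)
Record at_cell k l (s : state R) : Prop := AtCell {
  cell_in : inputs s;
  cell_k : (k < K)%N;
  cell_l : (l < L)%N;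
  cell_vk : var s vk = k%:R;
  cell_vl : var s vl = l%:R }.

Lemma at_cell_set_var s k l i v : (5 < i)%N ->
  at_cell k l s -> at_cell k l (set_var s i v).
Proof.
by case: i => [|[|[|[|[|[|i]]]]]] // _ [[? ? ? ? ? ? ? ?] ? ? ? ?]; do !split.
Qed.

Lemma cellE k l s : at_cell k l s ->
  value s cell = (k * L + l)%:R /\ safe G s cell.
Proof.
move=> [[eK eL _ _ _ _ _ _] kK lL ek el]; rewrite cell.unlock /=.
rewrite ek eL el -natrM -natrD; split=> //; split=> //; last by apply: Gnat; nia.
by split=> //; apply: Gnat; nia.
Qed.

Lemma ElemE (s : state R) a e n : value s e = n%:R -> safe G s e ->
  value s (Elem a e) = arr s a n /\ safe G s (Elem a e).
Proof. by move=> /= -> ?; rewrite natrK natr_nat. Qed.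

Lemma sqdevE k l s : at_cell k l s ->
  [/\ value s (sqdev aY1) = dev Y1 k l * dev Y1 k l, safe G s (sqdev aY1),
      value s (sqdev aY2) = dev Y2 k l * dev Y2 k l & safe G s (sqdev aY2)].
Proof.
move=> c; have [e g] := cellE c.
have [eX gX] := ElemE aX e g.
have [[eK eL et ee iX iM iY1 iY2] kK lL ek el] := c.
have gk : var s vk \is a Num.nat by rewrite ek natr_nat.
rewrite sqdev.unlock; move: cell e g {eX gX} => e' e g /=.
rewrite e ek !natrK !natr_nat iX iY1 iY2 -!/(dev _ _ _).
have := (GdevY1 kK lL, GdevY2 kK lL, GsqY1 kK lL, GsqY2 kK lL).
by move=> [[[? ?] ?] ?]; do !split.
Qed.


Lemma esize_sqdev a : esize (sqdev a) = 7.
Proof. by rewrite sqdev.unlock cell.unlock. Qed.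
Lemma esize_cell : esize cell = 2. Proof. by rewrite cell.unlock. Qed.

(** ** Moments and the largest cost *)

(** [D] is the largest absolute value of a term of the cost among the entries
    before (k, l), or 0.  The witness matters: it makes [D] a number of bounded
    size. *)
Definition dmax_upto k l (D : R) : Prop :=
  [/\ 0 <= D,
      forall i j, (i < K)%N -> (j < L)%N -> (i < k)%N || ((i == k) && (j < l)%N) ->
        `|dif i j| <= D
    & D = 0 \/ exists i j, [/\ (i < K)%N, (j < L)%N & D = `|dif i j| ] ].

Lemma dmax_uptoS k l D : (k < K)%N -> (l < L)%N -> dmax_upto k l D ->
  dmax_upto k l.+1 (Num.max D `|dif k l|).
Proof.
move=> kK lL [D0 lb wit]; split.
- by rewrite le_max D0.
- move=> i j iK jL; rewrite ltnS (leq_eqVlt j) le_max => h.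
  case: (boolP ((i == k) && (j == l))) => [/andP[/eqP-> /eqP->]|ne].
    by rewrite lexx orbT.
  rewrite lb //; move: h ne.
  by case: (i < k)%N (i == k) (j == l) (j < l)%N => [] [] [] [].
- case: leP => _; last exact: wit.
  by right; exists k, l.
Qed.

Lemma dmax_upto0 k D : dmax_upto k L D -> dmax_upto k.+1 0 D.
Proof.
case=> D0 lb wit; split=> // i j iK jL; rewrite andbF orbF ltnS leq_eqVlt => h.
by apply: lb => //; rewrite jL andbT orbC.
Qed.

Record moments_inv k l (s : state R) : Prop := MomentsInv {
  mi_in : inputs s;
  mi_vk : var s vk = k%:R;
  mi_E : var s vE = moment k l;
  mi_D : dmax_upto k l (var s vD);
  mi_q : var s vq = 0;
  mi_h : var s vh = 0;
  mi_N : var s vN = 0;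
  mi_F : var s vF = 0;
  mi_Q : forall n, arr s aQ n = 0;
  mi_P : forall n, arr s aP n = 0 }.

Lemma moments_step k l s : at_cell k l s -> moments_inv k l s ->
  wp G 30
    (vE ::= Var vE [+] Elem aM cell [*] sqdev aY2 ;;
     vd ::= sqdev aY1 [-] sqdev aY2 ;;
     If Lt (Var vD) (Var vd) (vD ::= Var vd) Skip ;;
     If Lt (Var vD) (Const 0 [-] Var vd) (vD ::= Const 0 [-] Var vd) Skip)
    s (fun s' => moments_inv k l.+1 s' /\ var s' vl = l%:R).
Proof.
move=> c inv.
apply: (wp_weak (n := 11 + (15 + (1 + 3)))); [by []|by move=> ?; exact|].
have [[ins kK lL vk_k vl_l] [_ _ eE eD eq eh eN eF aQ0 aP0]] := (c, inv).
have [eK eL et ee iX iM iY1 iY2] := ins.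
have [v1 g1 v2 g2] := sqdevE c.
have [e2 ge2] := ElemE aM (proj1 (cellE c)) (proj2 (cellE c)).
have eE' : moment k l + moment_term k l = moment k l.+1 by rewrite /moment big_ord_recr addrA.
apply: wp_seq; apply: wp_assign; first by rewrite /= ?esize_sqdev ?esize_cell.
  split=> //; last by rewrite !valueE eE e2 v2 iM eE'; apply: Gmoment.
  by split=> //; rewrite !valueE e2 v2 iM; apply: Gterm.
rewrite !valueE eE e2 v2 iM eE'.
have {v1 g1 v2 g2} [v1 g1 v2 g2] :=
  sqdevE (at_cell_set_var (s := s) (moment k l.+1) (isT : (5 < 8)%N) c).
apply: wp_seq; apply: wp_assign; first by rewrite /= ?esize_sqdev ?esize_cell.
  by split=> //; rewrite !valueE v1 v2; apply: Gdif.
rewrite !valueE v1 v2 -/(dif k l).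
set s1 := set_var _ _ _.
have close s' : arr s' = arr s -> (forall i, i != vD -> var s' i = var s1 i) ->
    var s' vD = Num.max (Num.max (var s vD) (dif k l)) (0 - dif k l) ->
    moments_inv k l.+1 s' /\ var s' vl = l%:R.
  rewrite -maxA sub0r maxrN => arrE varE vDE; split; last by rewrite varE.
  split; rewrite ?vDE ?arrE ?varE //=; first by split; rewrite ?varE ?arrE.
  exact: dmax_uptoS.
apply: wp_seq; apply: (@wp_if _ _ 0) => //.
  rewrite /= => ltd; apply: wp_assign => //.
  apply: (@wp_if _ _ 1) => //=.
  - by do !split=> //; apply: Gndif.
  - move=> ltd2; apply: wp_assign => //=; first by split=> //; apply: Gndif.
    by apply: close => //= [[|[|[|[|[|[|[|[]]]]]]]]|] //=; rewrite !max_r // ltW.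
  - rewrite -leNgt => led2; apply: wp_skip.
    by apply: close => //= [[|[|[|[|[|[|[|[]]]]]]]]|] //=; rewrite max_l // max_r // ltW.
rewrite /= -leNgt => led; apply: wp_skip.
apply: (@wp_if _ _ 1) => //=.
- by split=> //; apply: Gndif.
- move=> ltd2; apply: wp_assign => //=; first by split=> //; apply: Gndif.
  by apply: close => //= [[|[|[|[|[|[|[|[]]]]]]]]|] //=; rewrite (max_l led) max_r // ltW.
- rewrite -leNgt => led2; apply: wp_skip.
  by apply: close => //=; rewrite (max_l led) max_l.
Qed.

Lemma moments_spec s : inputs s -> (forall i, (3 < i)%N -> var s i = 0) ->
  (forall a n, (3 < a)%N -> arr s a n = 0) ->
  wp G (K * (L * (30 + 2) + 1 + 2) + 1) moments s (moments_inv K 0).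
Proof.
move=> ins v0 a0; apply: (wp_for (I := fun k => moments_inv k 0)) => //.
- by move=> m s1 mK []; case=> ->.
- by move=> m mK; apply: Gnat; lia.
- move=> k s1 kK inv1.
  apply: (wp_weak (n := L * (30 + 2) + 1)
            (Q := fun s => moments_inv k L s /\ var s vl = L%:R)) => //.
    move=> s2 [[ins2 vk2 eE eD eq eh eN eF aQ0 aP0] _].
    split=> //; split; rewrite //=; first by case: ins2.
    + by rewrite eE /moment big_ord0 big_ord_recr addr0.
    + exact: dmax_upto0.
  apply: (wp_for (I := fun l s => moments_inv k l s /\ var s vl = l%:R)).
  + by move=> l s2 lL [] []; case=> _ -> *.
  + by move=> l lL; apply: Gnat; lia.
  + move=> l s2 lL [inv2 vl2].
    have c2 : at_cell k l s2 by case: inv2.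
    apply: wp_weak (moments_step c2 inv2) => // s3 [inv3 vl3]; split=> //.
    by case: inv3 => -[].
  + by case: inv1 => -[].
- split; rewrite /= ?v0 //; first by case: ins.
  + by rewrite /moment !big_ord0 addr0.
  + by split=> // [i j _ _|]; [rewrite ltn0 andbF|left].
  + by move=> n; rewrite a0.
  + by move=> n; rewrite a0.
Qed.

(** ** The resolution *)

(** This identifies the value found by the program with the [D] that is fixed
    below, so that the sizes of [D] and of the numbers derived from it can be
    assumptions of the section. *)
Lemma dmax_upto_uniq k l D D' :
  dmax_upto k l D -> dmax_upto k l D' ->
  (forall i j, (i < K)%N -> (j < L)%N -> (i < k)%N || ((i == k) && (j < l)%N)) ->
  D = D'.
Proof.
move=> [D0 lb wit] [D0' lb' wit'] all; apply/eqP; rewrite eq_le.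
apply/andP; split.
  by case: wit => [->//|[i [j [iK jL ->]]]]; apply: lb' (all _ _ _ _).
by case: wit' => [->//|[i [j [iK jL ->]]]]; apply: lb (all _ _ _ _).
Qed.

Variables (D : R) (N : nat).
Hypothesis DE : dmax_upto K 0 D.
Hypothesis N_lt : forall n, (n < N)%N -> eps < K%:R * D / n.+1%:R.
Hypothesis N_ge : K%:R * D / N.+1%:R <= eps.
Hypothesis eps0 : 0 < eps.

Definition nslots := (2 * N).+1.
Definition nsums := (2 * N * K).+1.
Definition scale := N%:R / D.
Definition mesh := D / N%:R.

Hypothesis NB_sums : (K.+1 * nsums + nsums <= NB)%N.
Hypothesis NB_slots : (K.+1 * nslots + N + 2 <= NB)%N.
Hypothesis GKD : G (K%:R * D).
Hypothesis GKDn : forall n, (n <= N)%N -> G (K%:R * D / n.+1%:R).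
Hypothesis Gscale : (0 < N)%N -> G scale.
Hypothesis Gmesh : (0 < N)%N -> G mesh.

Lemma D_neq0 : (0 < N)%N -> D != 0.
Proof.
move=> N0; apply/eqP => D0; have := N_lt N0.
by rewrite D0 mulr0 mul0r ltNge ltW.
Qed.

Record setup (s : state R) : Prop := Setup {
  su_in : inputs s;
  su_E : var s vE = moment K 0;
  su_N : var s vN = N%:R;
  su_q : var s vq = scale;
  su_h : var s vh = mesh;
  su_F : var s vF = 0;
  su_W : var s vW = nsums%:R;
  su_B : var s vB = nslots%:R }.

(** The assumptions on [N] say that the test of the loop holds exactly for the
    counters below [N]; so the number of rounds is [N]. *)
Lemma resolution_spec s : moments_inv K 0 s ->
  wp G (N * (1 + 4) + 4 + (3 + (2 + 3))) resolution s
    (fun s' => [/\ setup s', forall n, arr s' aQ n = 0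
                 & forall n, arr s' aP n = 0]).
Proof.
move=> inv0; have := NB_slots; have := NB_sums; rewrite /nsums /nslots => hW hB; apply: wp_seq.
pose I n s := [/\ inputs s /\ var s vE = moment K 0, var s vD = D,
  [/\ var s vq = 0, var s vh = 0 & var s vF = 0], var s vN = n%:R
  & (forall n, arr s aQ n = 0) /\ (forall n, arr s aP n = 0)].
apply: (wp_weak (Q := I N) (leqnn _)); last first.
  apply: (wp_while (I := I)) => [n s1 nN [[[eK ? ? ee ? ? ? ?] _] eD _ eN _]|n s1 nN|].
  - rewrite /= eK ee eD eN natr1; split=> //.
      split=> //; rewrite ?pnatr_eq0 //; last exact: GKDn.
      by do !split=> //; apply: Gnat; lia.
    case: ltngtP nN => // [/N_lt->//|->] _; by rewrite ltNge N_ge.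
  - move=> [[[eK eL et ee ? ? ? ?] eE] eD [eq eh eF] eN [aQ0 aP0]].
    apply: wp_assign => //=; rewrite eN natr1.
      by split=> //; apply: Gnat; lia.
    by split=> //; split.
  - case: inv0 => ? ? ? eD ? ? ? ? ? ?; split=> //.
    by apply: dmax_upto_uniq eD DE _ => i j iK; rewrite iK.
move=> {inv0}s1 [[ins eE] eD [eq eh eF] eN [aQ0 aP0]].
have [eK eL et ee iX iM iY1 iY2] := ins.
apply: wp_seq; apply: (wp_weak (Q := fun s2 =>
  [/\ inputs s2, [/\ var s2 vE = moment K 0, var s2 vq = scale, var s2 vh = mesh,
    var s2 vF = 0 & var s2 vN = N%:R]
  & (forall n, arr s2 aQ n = 0) /\ (forall n, arr s2 aP n = 0)]) (leqnn _)).
  move=> {s1 ins eE eD eq eh eF eN aQ0 aP0 eK eL et ee iX iM iY1 iY2} s2.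
  move=> [[eK eL et ee iX iM iY1 iY2] [eE eq eh eF eN] [aQ0 aP0]].
  have EB : 2%:~R * N%:R + 1%:~R = nslots%:R :> R by rewrite -natrM natr1.
  have EW : 2%:~R * N%:R * K%:R + 1%:~R = nsums%:R :> R by rewrite -!natrM natr1.
  apply: wp_seq; apply: wp_assign => //=; rewrite eN ?EB.
    by do !split; rewrite //= -?natrM; apply: Gnat; rewrite ?/nslots; lia.
  apply: wp_assign => //=; rewrite eN eK ?EW.
    have hNK : (2 * N * K <= NB)%N by nia.
    by do !split; rewrite //= -?natrM; apply: Gnat; rewrite ?/nsums; lia.
  by split=> //; split=> //; split.
apply: (@wp_if _ _ 2) => //=; rewrite eN ltr0n => N0.
  rewrite -[2%N]/(1 + 1)%N.
  apply: wp_seq; apply: wp_assign => //=; rewrite eN eD.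
    by split=> //; [exact: D_neq0|exact: Gscale].
  apply: wp_assign => //=; rewrite eN eD.
    by split=> //; [rewrite pnatr_eq0 -lt0n|exact: Gmesh].
  by split=> //; split.
move: N0; rewrite -leqNgt leqn0 => /eqP N0.
apply: wp_skip; split=> //; split=> //.
  by rewrite eq /scale N0 mul0r.
by rewrite eh /mesh N0 invr0 mulr0.
Qed.

(** ** The distribution of the rounded costs *)

Definition slot k l : nat := Num.truncn (round_nearest (dif k l * scale) + N%:R).

Lemma difq_le k l : (k < K)%N -> (l < L)%N -> `|dif k l * scale| <= N%:R.
Proof.
move=> kK lL; case: (posnP N) => [N0|N0]; first by rewrite /scale N0 mul0r mulr0 normr0.
have [D0 lb _] := DE; rewrite /scale mulrCA normrM ger0_norm // ler_piMr //.
by rewrite normrM normfV (ger0_norm D0) ler_pdivrMr ?mul1r ?lb ?kK // lt0r D_neq0.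
Qed.

Lemma slotE k l : (k < K)%N -> (l < L)%N ->
  round_nearest (dif k l * scale) + N%:R = (slot k l)%:R /\ (slot k l < nslots)%N.
Proof.
move=> kK lL; have := round_nearest_le (difq_le kK lL).
rewrite ler_norml /slot => /andP[r1 r2].
have nat_r : round_nearest (dif k l * scale) + N%:R \is a Num.nat.
  rewrite natrEint; apply/andP; split; last by lra.
  by rewrite rpredD // ?rpred_nat // /round_nearest intr_int.
rewrite truncnK //; split=> //; rewrite ltnS -(ler_nat R) truncnK // natrM; lra.
Qed.

(** The generating polynomial of a rounded and shifted term of the cost, summed
    over the first [l] atoms of the marginal.  Products of such polynomials
    describe the convolutions. *)
Definition slot_gen_upto k l : {poly R} :=
  \sum_(j < l) M (k * L + j)%N *: 'X^(slot k j).
Definition slot_gen k : {poly R} := slot_gen_upto k L.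
Definition sum_gen k : {poly R} := \prod_(i < k) slot_gen i.

Lemma slot_gen_upto_big k l j : (k < K)%N -> (l <= L)%N -> (nslots <= j)%N ->
  (slot_gen_upto k l)`_j = 0.
Proof.
move=> kK lL Bj; rewrite coef_sum big1 // => i _.
have [_ sB] := slotE kK (leq_trans (ltn_ord i) lL).
by rewrite coefZ coefXn gtn_eqF ?mulr0 // (leq_trans sB).
Qed.

Definition conv_upto k i j : R :=
  \sum_(m < j) (if (m <= i)%N then (sum_gen k)`_(i - m) * (slot_gen k)`_m else 0).

(** The inner loop may stop at the number of slots because the generating
    polynomial of one term has no higher coefficients. *)
Lemma convE k i : (k < K)%N -> conv_upto k i nslots = (sum_gen k.+1)`_i.
Proof.
move=> kK; rewrite /sum_gen big_ord_recr /= coefMr -/(sum_gen k).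
pose f m := if (m <= i)%N then (sum_gen k)`_(i - m) * (slot_gen k)`_m else 0.
have widen n : (n <= nslots + i.+1)%N -> (forall m, (n <= m)%N -> f m = 0) ->
    \sum_(m < n) f m = \sum_(m < nslots + i.+1) f m.
  move=> le0 f0; rewrite (big_ord_widen _ f le0) big_mkcond; apply: eq_bigr => m _.
  by case: ltnP => // /f0.
rewrite [LHS]widen ?leq_addr // => [|m Bm]; last first.
  by rewrite /f slot_gen_upto_big // mulr0; case: ifP.
rewrite -[LHS](widen i.+1) ?leq_addl // => [|m im]; last by rewrite /f leqNgt im.
by apply: eq_bigr => m _; rewrite /f -ltnS ltn_ord.
Qed.

Hypothesis Gdifq : forall k l, (k < K)%N -> (l < L)%N -> G (dif k l * scale).
Hypothesis Ground : forall k l, (k < K)%N -> (l < L)%N ->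
  G (round_nearest (dif k l * scale)).
Hypothesis Ggen : forall k l j, (k < K)%N -> (l <= L)%N -> G (slot_gen_upto k l)`_j.
Hypothesis Gprod : forall k i j, (k < K)%N -> G ((sum_gen k)`_i * (slot_gen k)`_j).
Hypothesis Gconv : forall k i j, (k < K)%N -> (j <= nslots)%N -> G (conv_upto k i j).

Record bucket_inv k l (s : state R) : Prop := BucketInv {
  bi_su : setup s;
  bi_k : var s vk = k%:R;
  bi_l : var s vl = l%:R;
  bi_P : forall i, (i < nsums)%N -> arr s aP (k * nsums + i)%N = (sum_gen k)`_i;
  bi_Q : forall j, (j < nslots)%N -> arr s aQ (k * nslots + j)%N = (slot_gen_upto k l)`_j;
  bi_Q0 : forall k' j, (k < k')%N -> (j < nslots)%N -> arr s aQ (k' * nslots + j)%N = 0 }.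

Lemma bucketing_spec k s : (k < K)%N -> bucket_inv k 0 (set_var s vl 0) ->
  wp G (L * (25 + 2) + 1) bucketing s (bucket_inv k L).
Proof.
move=> kK inv0; have := NB_slots; have := NB_sums; have gl := NB_inputs.
rewrite /nsums /nslots => hW hB.
apply: wp_for => // [l s1 lL|m mL|l s1 lL].
- by case=> -[[? ? ? ? ? ? ? ?] *].
- by apply: Gnat; lia.
move=> {inv0}[[[eK eL et ee iX iM iY1 iY2] eE eN eq eh eF eW eB] vk1 vl1 Pk Qk Q0].
have ins : inputs s1 by [].
have c : at_cell k l s1 by [].
have [v1 g1 v2 g2] := sqdevE c; have [sl sB] := slotE kK lL.
rewrite -[25%N]/(18 + 7)%N.
have slB : (slot k l <= NB)%N by rewrite /nslots in sB; lia.
apply: wp_seq; apply: wp_assign; first by rewrite /= !esize_sqdev.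
  do !split=> //; rewrite !valueE v1 v2 -/(dif k l).
  - exact: Gdif.
  - by rewrite eq; apply: Gdifq.
  - by rewrite eq; apply: Ground.
  - by rewrite eq eN sl; apply: Gnat.
rewrite !valueE v1 v2 -/(dif k l) eq eN sl.
set s2 := set_var _ _ _.
have c2 : at_cell k l s2 by apply: at_cell_set_var.
have [ec gc] := cellE c2; have [eM gM] := ElemE aM ec gc.
have e2 : value s2 (Var vk [*] Var vB [+] Var vd) = (k * nslots + slot k l)%:R.
  by rewrite !valueE /= vk1 eB -natrM -natrD.
have kB : (k * nslots + slot k l <= NB)%N.
  apply: leq_trans (_ : k.+1 * nslots <= _)%N.
    by rewrite mulSn addnC leq_add2r ltnW.
  apply: leq_trans (_ : K.+1 * nslots <= _)%N; last by have := NB_slots; lia.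
  by rewrite leq_mul2r ltnW ?orbT.
have g3 : safe G s2 (Var vk [*] Var vB [+] Var vd).
  split=> //; last by rewrite e2; apply: Gnat.
  by split=> //; rewrite !valueE /= vk1 eB -natrM; apply: Gnat; lia.
have [eQ gQ] := ElemE aQ e2 g3.
have QE : value s2 (Elem aQ (Var vk [*] Var vB [+] Var vd) [+] Elem aM cell)
    = (slot_gen_upto k l.+1)`_(slot k l).
  rewrite valueE eQ eM /= Qk // iM /slot_gen_upto big_ord_recr /= coefD coefZ coefXn.
  by rewrite eqxx mulr1.
apply: wp_store e2 _ => //.
- by rewrite /= esize_cell.
- by split=> //; rewrite QE; apply: Ggen.
rewrite QE; split=> //; split; rewrite ?vk1 //.
- move=> j jB /=; rewrite stride_inj // eqxx /=; case: eqP => [->//|/eqP js].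
  by rewrite Qk // /slot_gen_upto big_ord_recr /= coefD coefZ coefXn (negPf js) mulr0 addr0.
- by move=> k' j kk' jB /=; rewrite stride_inj // (gtn_eqF kk') /= Q0.
Qed.

Record conv_inv k i (s : state R) : Prop := ConvInv {
  ci_su : setup s;
  ci_k : var s vk = k%:R;
  ci_i : var s vi = i%:R;
  ci_P : forall m, (m < nsums)%N -> arr s aP (k * nsums + m)%N = (sum_gen k)`_m;
  ci_P' : forall m, (m < i)%N -> arr s aP (k.+1 * nsums + m)%N = (sum_gen k.+1)`_m;
  ci_Q : forall j, (j < nslots)%N -> arr s aQ (k * nslots + j)%N = (slot_gen k)`_j;
  ci_Q0 : forall k' j, (k < k')%N -> (j < nslots)%N -> arr s aQ (k' * nslots + j)%N = 0 }.

Lemma convolution_step k i j s : (k < K)%N -> (i < nsums)%N -> (j < nslots)%N ->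
  [/\ conv_inv k i s, var s vj = j%:R & var s vA = conv_upto k i j] ->
  wp G 8
    (If Le (Var vj) (Var vi)
      (vA ::= Var vA [+] Elem aP (Var vk [*] Var vW [+] (Var vi [-] Var vj))
                     [*] Elem aQ (Var vk [*] Var vB [+] Var vj))
      Skip)
    s (fun s' => [/\ conv_inv k i s', var s' vj = j%:R
                   & var s' vA = conv_upto k i j.+1]).
Proof.
move=> kK iW jB [inv ej eA]; have [su ek ei Pk Pk' Qk Q0] := inv.
have [[eK eL et ee iX iM iY1 iY2] eE eN eq eh eF eW eB] := su.
have hB := NB_slots; have hW := NB_sums.
have kW : (k * nsums + nsums <= NB)%N by nia.
have kB : (k * nslots + nslots <= NB)%N by nia.
apply: (@wp_if _ _ 7) => //=; rewrite ej ei ler_nat.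
  move=> ji; have vij : i%:R - j%:R = (i - j)%:R :> R by rewrite natrB.
  have e1 : value s (Var vk [*] Var vW [+] (Var vi [-] Var vj)) = (k * nsums + (i - j))%:R.
    by rewrite !valueE ek eW ei ej vij -natrM -natrD.
  have g1 : safe G s (Var vk [*] Var vW [+] (Var vi [-] Var vj)).
    split=> //; last by rewrite e1; apply: Gnat; lia.
      by split=> //; rewrite !valueE ek eW -natrM; apply: Gnat; lia.
    by split=> //; rewrite !valueE ei ej vij; apply: Gnat; lia.
  have e2 : value s (Var vk [*] Var vB [+] Var vj) = (k * nslots + j)%:R.
    by rewrite !valueE ek eB ej -natrM -natrD.
  have g2 : safe G s (Var vk [*] Var vB [+] Var vj).
    split=> //; last by rewrite e2; apply: Gnat; lia.
    by split=> //; rewrite !valueE ek eB -natrM; apply: Gnat; lia.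
  have [eP gP] := ElemE aP e1 g1; have [eQ gQ] := ElemE aQ e2 g2.
  have eprod : value s (Elem aP (Var vk [*] Var vW [+] (Var vi [-] Var vj))
      [*] Elem aQ (Var vk [*] Var vB [+] Var vj)) = (sum_gen k)`_(i - j) * (slot_gen k)`_j.
    by rewrite valueM eP eQ Pk ?Qk // (leq_ltn_trans (leq_subr _ _)).
  have esum : value s (Var vA [+] Elem aP (Var vk [*] Var vW [+] (Var vi [-] Var vj))
      [*] Elem aQ (Var vk [*] Var vB [+] Var vj)) = conv_upto k i j.+1.
    by rewrite valueD eprod value_var eA /conv_upto big_ord_recr /= ji.
  apply: wp_assign => //.
  split=> //; last by rewrite esum; apply: Gconv.
  by split=> //; rewrite eprod; apply: Gprod.
move=> ji; apply: wp_skip; split=> //.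
by rewrite eA /conv_upto big_ord_recr /= (negPf ji) addr0.
Qed.

Lemma convolution_spec k s : (k < K)%N -> conv_inv k 0 (set_var s vi 0) ->
  wp G (nsums * (nslots * (8 + 2) + 1 + 3 + 2) + 1) convolution s (conv_inv k nsums).
Proof.
move=> kK inv0; have hB := NB_slots; have hW := NB_sums.
have kW : (k.+1 * nsums + nsums <= NB)%N by nia.
apply: wp_for => // [i s1 iW|m mW|i s1 iW inv1].
- by case=> -[[? ? ? ? ? ? ? ?] *].
- by apply: Gnat; lia.
rewrite -[(_ + 1 + 3)%N]add0n.
apply: wp_seq; apply: wp_assign => //; apply: wp_seq.
pose I j s := [/\ conv_inv k i s, var s vj = j%:R & var s vA = conv_upto k i j].
apply: (wp_weak (Q := I nslots)) (leqnn _) _ _; last first.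
  apply: (wp_for (I := I)) => [j s2 _ [] [] []|j jB|j s2 jB inv2|] //.
  - by apply: Gnat; lia.
  - have [_ ej _] := inv2; apply: wp_weak (convolution_step kK iW jB inv2) => //.
    by move=> s3 [[[[? ? ? ? ? ? ? ?] ? ? ? ? ? ? ?] ? ? ? ? ? ?] ? ?].
  - case: inv1 => [[[? ? ? ? ? ? ? ?] ? ? ? ? ? ? ?] ? ? ? ? ? ?].
    by split; rewrite //= /conv_upto big_ord0.
move=> {inv1}s2 [[su ek ei Pk Pk' Qk Q0] _]; rewrite convE // => eA.
have [[eK eL et ee iX iM iY1 iY2] eE eN eq eh eF eW eB] := su.
have e1 : value s2 ((Var vk [+] Const 1) [*] Var vW [+] Var vi) = (k.+1 * nsums + i)%:R.
  by rewrite !valueE ek eW ei natr1 -natrM -natrD.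
have g1 : safe G s2 ((Var vk [+] Const 1) [*] Var vW [+] Var vi).
  split=> //; last by rewrite e1; apply: Gnat; lia.
  split=> //; last by rewrite !valueE ek eW natr1 -natrM; apply: Gnat; lia.
  by split=> //; rewrite !valueE ek natr1; apply: Gnat; nia.
apply: wp_store e1 _ => //; rewrite value_var eA; split=> //; split=> //=.
- by move=> m mW; rewrite stride_inj // ltn_eqF // Pk.
- move=> m; rewrite ltnS leq_eqVlt => /orP[/eqP->|mi]; first by rewrite eqxx.
  by rewrite stride_inj ?(ltn_trans mi) // eqxx (ltn_eqF mi) Pk'.
Qed.

(** ** The greedy sum *)

Definition mass_below n : R := \sum_(i < n) (sum_gen K)`_i.
Definition excess n : R := \sum_(j < n) Num.max 0 (t - mass_below j.+1).
Definition result : R := moment K 0 + mesh * (excess nsums - t * (N * K)%:R).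

Hypothesis Gbelow : forall n, (n <= nsums)%N -> G (mass_below n).
Hypothesis Gt_below : forall n, (n <= nsums)%N -> G (t - mass_below n).
Hypothesis Gexcess : forall n, (n <= nsums)%N -> G (excess n).
Hypothesis NB_NK : (N * K <= NB)%N.
Hypothesis Gres1 : G (t * (N * K)%:R).
Hypothesis Gres2 : G (excess nsums - t * (N * K)%:R).
Hypothesis Gres3 : G (mesh * (excess nsums - t * (N * K)%:R)).
Hypothesis Gres : G result.

Record greedy_inv n (s : state R) : Prop := GreedyInv {
  gi_in : inputs s;
  gi_E : var s vE = moment K 0;
  gi_N : var s vN = N%:R;
  gi_h : var s vh = mesh;
  gi_W : var s vW = nsums%:R;
  gi_i : var s vi = n%:R;
  gi_P : forall i, (i < nsums)%N -> arr s aP (K * nsums + i)%N = (sum_gen K)`_i;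
  gi_F : var s vF = mass_below n;
  gi_A : var s vA = excess n }.

Lemma greedy_spec s : setup s ->
  (forall i, (i < nsums)%N -> arr s aP (K * nsums + i)%N = (sum_gen K)`_i) ->
  wp G (nsums * (6 + 2) + 1) greedy s (greedy_inv nsums).
Proof.
move=> [ins eE eN eq eh eF eW eB] PK; rewrite -[X in wp _ X]add0n.
have hW := NB_sums; have KW : (K * nsums + nsums <= NB)%N by nia.
apply: wp_seq; apply: wp_assign => //.
apply: wp_for => // [i s1 iW|m mW|i s1 iW|].
- by case=> -[? ? ? ? ? ? ? ?].
- by apply: Gnat; lia.
- move=> {ins eE eN eq eh eF eW eB PK}.
  move=> [[eK eL et ee iX iM iY1 iY2] eE eN eh eW ei PK eF eA].
  rewrite -[6%N]/(3 + (1 + 2))%N.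
  have e1 : value s1 (Var vK [*] Var vW [+] Var vi) = (K * nsums + i)%:R.
    by rewrite !valueE eK eW ei -natrM -natrD.
  have g1 : safe G s1 (Var vK [*] Var vW [+] Var vi).
    split=> //; last by rewrite e1; apply: Gnat; lia.
    by split=> //; rewrite !valueE eK eW -natrM; apply: Gnat; lia.
  have [eP gP] := ElemE aP e1 g1.
  have e2 : value s1 (Var vF [+] Elem aP (Var vK [*] Var vW [+] Var vi)) = mass_below i.+1.
    by rewrite valueD eP PK // value_var eF /mass_below big_ord_recr.
  apply: wp_seq; apply: wp_assign => //.
    by split=> //; rewrite e2; apply: Gbelow.
  rewrite e2; apply: (@wp_if _ _ 2) => //=; rewrite et => lt.
    have e3 : excess i + (t - mass_below i.+1) = excess i.+1.
      by rewrite /excess big_ord_recr /= max_r // subr_ge0 ltW.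
    apply: wp_assign => //=; rewrite eA et e3.
      by do !split=> //; [apply: Gt_below|apply: Gexcess].
    by split=> //; split=> //; split.
  apply: wp_skip; split=> //; split=> //=.
  by rewrite eA /excess big_ord_recr /= max_l ?addr0 // subr_le0 leNgt.
- split=> //=; first by case: ins.
  + by rewrite eF /mass_below big_ord0.
  + by rewrite /excess big_ord0.
Qed.

(** The cost of the program as the rules of the program logic produce it; the
    shape is kept so that it matches them syntactically. *)
Definition transport_cost_bound : nat :=
  K * (L * (30 + 2) + 1 + 2) + 1 + (N * (1 + 4) + 4 + (3 + (2 + 3)) + (0 +
   (K * (L * (25 + 2) + 1 + (nsums * (nslots * (8 + 2) + 1 + 3 + 2) + 1) + 2) + 1
    + (nsums * (6 + 2) + 1 + 5)))).

Lemma transport_prog_spec s : inputs s -> (forall i, (3 < i)%N -> var s i = 0) ->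
  (forall a n, (3 < a)%N -> arr s a n = 0) ->
  wp G transport_cost_bound transport_prog s (fun s' => output s' = result).
Proof.
move=> ins v0 a0; apply: wp_seq.
apply: wp_weak (leqnn _) _ (moments_spec ins v0 a0) => s1 inv1.
apply: wp_seq; apply: wp_weak (leqnn _) _ (resolution_spec inv1) => s2 [su Q0 P0].
apply: wp_seq; apply: (wp_store (k := 0)) => //; apply: wp_seq.
pose I k s := [/\ setup s, var s vk = k%:R,
  forall i, (i < nsums)%N -> arr s aP (k * nsums + i)%N = (sum_gen k)`_i
  & forall k' j, (k <= k')%N -> (j < nslots)%N -> arr s aQ (k' * nslots + j)%N = 0].
apply: (wp_weak (Q := I K)) (leqnn _) _ _; last first.
  apply: (wp_for (I := I)) => [k s3 _ [[[]]]|k kK|k s3 kK [su3 ek3 P3 Q3]|] //.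
  - by apply: Gnat; have := NB_inputs; lia.
  - apply: wp_seq; apply: wp_weak (leqnn _) _ (bucketing_spec kK _); last first.
      split=> //=; first by case: su3 => -[].
      + by move=> j jB; rewrite Q3 // /slot_gen_upto big_ord0 coef0.
      + by move=> k' j kk' jB; rewrite Q3 // ltnW.
    move=> s4 [su4 ek4 el4 P4 Q4 Q04].
    apply: wp_weak (leqnn _) _ (convolution_spec kK _); last first.
      by split=> //=; case: su4 => -[].
    move=> s5 [su5 ek5 ei5 P5 P5' Q5 Q05]; split=> //; split=> //.
    by case: su5 => -[].
  - split=> //=; first by case: su => -[].
      by move=> i iW; rewrite mul0n add0n P0 /sum_gen big_ord0 coef1; case: eqP.
move=> s3 [su3 _ P3 _]; apply: wp_seq.
apply: wp_weak (leqnn _) _ (greedy_spec su3 P3) => s4.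
move=> [[eK eL et ee iX iM iY1 iY2] eE eN eh eW ei PK eF eA].
apply: wp_assign => //=; rewrite eE eh eA et eN eK -natrM //.
by do !split=> //; apply: Gnat.
Qed.

End Verification.

(** * Sizes of the computed numbers *)

Section ProgramSizes.
Variables (R : realType) (K L N : nat) (X M Y1 Y2 : nat -> R) (t eps D : R).
Variables (Gam g tau m : nat).
Local Notation graded := (@graded R Gam).
Hypothesis Gam0 : (0 < Gam)%N.
Hypothesis gX : forall n, graded 1 tau (X n).
Hypothesis gY1 : forall n, graded 1 tau (Y1 n).
Hypothesis gY2 : forall n, graded 1 tau (Y2 n).

Local Notation weak := (graded_weak (Gam := Gam) (R := R)).

Lemma graded_dev Y k l : (forall n, graded 1 tau (Y n)) ->
  graded 1 tau.+1 (dev L X Y k l).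
Proof. by move=> gY; apply: gradedB. Qed.

Lemma graded_dev2 Y k l : (forall n, graded 1 tau (Y n)) ->
  graded 2 (2 * tau + 2) (dev L X Y k l * dev L X Y k l).
Proof.
move=> gY; rewrite (_ : 2 * tau + 2 = tau.+1 + tau.+1)%N; last by lia.
exact: (@gradedM _ _ 1 1 _ _ _ _ (graded_dev _ _ gY) (graded_dev _ _ gY)).
Qed.

Lemma graded_dif k l : graded 2 (2 * tau + 3) (dif L X Y1 Y2 k l).
Proof. by rewrite addnS; apply: gradedB; apply: graded_dev2. Qed.

Hypothesis gM : forall n, graded 1 tau (M n).

Lemma graded_term k l : graded 3 (3 * tau + 2) (moment_term L X M Y2 k l).
Proof.
rewrite (_ : 3 * tau + 2 = tau + (2 * tau + 2))%N; last by lia.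
exact: (@gradedM _ _ 1 2 _ _ _ _ (gM _) (graded_dev2 _ _ gY2)).
Qed.

Hypothesis Ktau : (K <= 2 ^ tau)%N.
Hypothesis Ltau : (L <= 2 ^ tau)%N.

Lemma graded_moment k l : (k <= K)%N -> (l <= L)%N ->
  graded 3 (5 * tau + 3) (moment L X M Y2 k l).
Proof.
move=> kK lL; rewrite addnS; apply: gradedD.
  rewrite (_ : 5 * tau + 2 = 3 * tau + 2 + tau + tau)%N; last by lia.
  apply: (graded_sum (F := fun i => \sum_(j < L) moment_term L X M Y2 i j)) => [|i _].
    exact: leq_trans Ktau.
  apply: (graded_sum (F := moment_term L X M Y2 i)) => // j _.
  exact: graded_term.
apply: (@weak 3 3 (3 * tau + 2 + tau)); [by []|lia|].
apply: (graded_sum (F := moment_term L X M Y2 k)) => [|j _].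
  exact: leq_trans Ltau.
exact: graded_term.
Qed.

Hypothesis DE : dmax_upto K L X Y1 Y2 K 0 D.

(** The maximum is attained, so it has the size of a single term. *)
Lemma graded_D : graded 2 (2 * tau + 3) D.
Proof.
have [_ _ [->|[i [j [_ _ ->]]]]] := DE; first exact: graded0.
have [di db] := graded_dif i j; split; last by rewrite normr_id.
by case: ger0P => _; rewrite ?mulNr ?rpredN.
Qed.

Lemma graded_KD : graded 2 (3 * tau + 3) (K%:R * D).
Proof.
rewrite (_ : 3 * tau + 3 = tau + (2 * tau + 3))%N; last by lia.
exact: (@gradedM _ _ 0 2 _ _ _ _ (graded_nat _ _ Ktau) graded_D).
Qed.

Hypothesis K0 : (0 < K)%N.

Lemma slots_sums : (nslots N <= nsums K N)%N.
Proof. by rewrite ltnS leq_pmulr. Qed.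

Hypothesis Wtau : (nsums K N <= 2 ^ tau)%N.

Lemma graded_N : graded 0 tau N%:R.
Proof.
by apply: graded_nat; apply: leq_trans Wtau; apply: leq_trans slots_sums;
  rewrite /nslots; lia.
Qed.

Lemma graded_slot_gen k l j : (l <= L)%N ->
  graded 1 (2 * tau) (slot_gen_upto L X M Y1 Y2 D N k l)`_j.
Proof.
move=> lL; rewrite /slot_gen_upto coef_sum mul2n -addnn.
apply: (graded_sum (F := fun i => (M (k * L + i)%N *: 'X^(slot L X Y1 Y2 D N k i))`_j)).
  exact: leq_trans Ltau.
move=> i _; rewrite coefZ coefXn; case: eqP => _; first by rewrite mulr1.
by rewrite mulr0; apply: graded0.
Qed.



Lemma graded_conv k i j c :
  (forall i, graded k c (sum_gen L X M Y1 Y2 D N k)`_i) -> (j <= nslots N)%N ->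
  graded k.+1 (c + 3 * tau) (conv_upto L X M Y1 Y2 D N k i j).
Proof.
move=> gs jB; rewrite (_ : c + 3 * tau = c + 2 * tau + tau)%N; last by lia.
apply: (graded_sum (F := fun a => if (a <= i)%N then
  (sum_gen L X M Y1 Y2 D N k)`_(i - a) * (slot_gen L X M Y1 Y2 D N k)`_a else 0)) => [|a _].
  exact: leq_trans (leq_trans jB _) (leq_trans slots_sums Wtau).
case: ifP => _; last exact: graded0.
by rewrite -addn1; apply: gradedM => //; apply: graded_slot_gen.
Qed.

Hypothesis N_lt : forall n, (n < N)%N -> eps < K%:R * D / n.+1%:R.
Hypothesis eps0 : 0 < eps.

(** Every convolution adds one factor [Gam] to the denominator and 3 [tau] to the
    exponent of the magnitude: 2 [tau] for a coefficient of a generating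
    polynomial, and [tau] for the number of summands. *)
Lemma graded_sum_gen k i : (k <= K)%N ->
  graded k (3 * tau * k) (sum_gen L X M Y1 Y2 D N k)`_i.
Proof.
elim: k i => [|k IH] i kK.
  rewrite /sum_gen big_ord0 coef1 muln0; apply: graded_nat; exact: leq_b1.
rewrite -(convE M DE N_lt eps0 i kK) mulnS addnC.
by apply: graded_conv => // i'; apply: IH; apply: ltnW.
Qed.

Lemma graded_below n : (n <= nsums K N)%N ->
  graded K (3 * tau * K + tau) (mass_below K L X M Y1 Y2 D N n).
Proof.
move=> nW; apply: (graded_sum (F := fun i => (sum_gen L X M Y1 Y2 D N K)`_i)) => [|i _].
  exact: leq_trans Wtau.
exact: graded_sum_gen.
Qed.

Hypothesis gt : graded 1 tau t.

Lemma graded_t_below n : (n <= nsums K N)%N ->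
  graded K.+1 (3 * tau * K + tau + 1) (t - mass_below K L X M Y1 Y2 D N n).
Proof.
move=> nW; rewrite addn1; apply: gradedB.
  by apply: weak gt; [lia|nia].
by apply: weak (graded_below nW).
Qed.

Lemma graded_excess n : (n <= nsums K N)%N ->
  graded K.+1 (3 * tau * K + 2 * tau + 1) (excess K L X M Y1 Y2 t D N n).
Proof.
move=> nW; rewrite (_ : 3 * tau * K + 2 * tau + 1 = 3 * tau * K + tau + 1 + tau)%N; last by lia.
apply: (graded_sum (F := fun j =>
  Num.max 0 (t - mass_below K L X M Y1 Y2 D N j.+1))) => [|j jn].
  exact: leq_trans Wtau.
by apply: graded_max0; apply: graded_t_below; apply: leq_trans nW.
Qed.

Lemma graded_tNK : graded 1 (2 * tau) (t * (N * K)%:R).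
Proof.
rewrite mul2n -addnn -[1%N]addn0; apply: gradedM => //; apply: graded_nat.
by apply: leq_trans Wtau; rewrite /nsums; lia.
Qed.

Local Notation rest :=
  (excess K L X M Y1 Y2 t D N (nsums K N) - t * (N * K)%:R).

Lemma graded_rest : graded K.+1 (3 * tau * K + 2 * tau + 2) rest.
Proof.
rewrite addnS; apply: gradedB; first exact: graded_excess.
by apply: weak graded_tNK; [lia|nia].
Qed.

Hypothesis Gamg : (Gam <= 2 ^ g)%N.
Hypothesis N_ge : K%:R * D / N.+1%:R <= eps.
Hypothesis mE : (3 * tau * K + 6 * tau + 6 + g * (K + 3) <= m)%N.

Local Notation good := (@is_fraction R (2 ^ m)).

Lemma fraction_div e b u v : graded e b u -> graded e b v -> v != 0 ->
  (e <= K + 3)%N -> (b <= 3 * tau * K + 6 * tau + 6)%N -> good (u / v).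
Proof.
move=> gu gv v0 eK bK; apply: (graded_div Gam0 Gamg gu gv) => //.
by apply: leq_trans mE; rewrite leq_add // leq_mul.
Qed.

Lemma fraction_of_graded e b v : graded e b v ->
  (e <= K + 3)%N -> (b <= 3 * tau * K + 6 * tau + 6)%N -> good v.
Proof.
move=> gv eK bK; apply: (graded_fraction Gam0 Gamg gv).
by apply: leq_trans mE; rewrite leq_add // leq_mul.
Qed.

(** The two products with [mesh] contain a division by [N]; they are quotients of
    graded numbers by [N], except for [N = 0], where [mesh] is 0. *)
Lemma transport_prog_sizes s :
  inputs K L X M Y1 Y2 t eps s -> (forall i, (3 < i)%N -> var s i = 0) ->
  (forall a n, (3 < a)%N -> arr s a n = 0) ->
  wp good (transport_cost_bound K L N) transport_prog s
    (fun s' => output s' = result K L X M Y1 Y2 t D N).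
Proof.
have WB := slots_sums; pose T := (2 ^ tau)%N.
have T0 : (0 < T)%N by rewrite expn_gt0.
have NB : (2 ^ (2 * tau + 3) = 8 * (T * T))%N by rewrite expnD mul2n -addnn expnD mulnC.
have TT : (T <= T * T)%N by rewrite leq_pmulr.
have KL : (K * L <= T * T)%N by rewrite leq_mul.
have KW : (K * nsums K N <= T * T)%N by rewrite leq_mul.
have KB : (K * nslots N <= T * T)%N by rewrite leq_mul // (leq_trans WB).
have tK : (tau <= tau * K)%N by rewrite leq_pmulr.
have D_gt0 : (0 < N)%N -> D != 0 := D_neq0 N_lt eps0.
have N_gt0 : (0 < N)%N -> N%:R != 0 :> R by rewrite pnatr_eq0 -lt0n.
have gD : graded 2 (3 * tau + 3) D by apply: weak graded_D; lia.
have gN : graded 2 (3 * tau + 3) N%:R by apply: weak graded_N; lia.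
have nB : (N < nslots N)%N by rewrite /nslots; lia.
have NKW : (N * K < nsums K N)%N by rewrite /nsums; lia.
have gDrest : graded (K + 3) (3 * tau * K + 4 * tau + 5) (D * rest).
  rewrite (_ : K + 3 = 2 + K.+1)%N; last by lia.
  rewrite (_ : 3 * tau * K + 4 * tau + 5 = 2 * tau + 3 + (3 * tau * K + 2 * tau + 2))%N; last by lia.
  by apply: gradedM; [apply: graded_D|apply: graded_rest].
have mesh_rest : (0 < N)%N -> mesh D N * rest = D * rest / N%:R.
  by move=> _; rewrite /mesh mulrAC.
have gN' : graded (K + 3) (3 * tau * K + 6 * tau + 6) N%:R.
  by apply: weak graded_N; lia.
have g0 : graded (K + 3) (3 * tau * K + 6 * tau + 6) 0 by apply: graded0.
have mesh0 : N = 0%N -> mesh D N = 0 by move=> ->; rewrite /mesh invr0 mulr0.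
apply: (transport_prog_spec (NB := (2 ^ (2 * tau + 3))%N) _ _ _ _ _ _ _ _ _ _
  DE N_lt N_ge eps0) => //.
- by move=> n nNB; apply: fraction_of_graded (graded_nat _ _ nNB) _ _; lia.
- by rewrite NB; lia.
- by move=> k l _ _; apply: fraction_of_graded (graded_dev _ _ gY1) _ _; lia.
- by move=> k l _ _; apply: fraction_of_graded (graded_dev _ _ gY2) _ _; lia.
- by move=> k l _ _; apply: fraction_of_graded (graded_dev2 _ _ gY1) _ _; lia.
- by move=> k l _ _; apply: fraction_of_graded (graded_dev2 _ _ gY2) _ _; lia.
- by move=> k l _ _; apply: fraction_of_graded (graded_dif _ _) _ _; lia.
- move=> k l _ _; rewrite sub0r.
  by apply: fraction_of_graded (gradedN (graded_dif _ _)) _ _; lia.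
- by move=> k l _ _; apply: fraction_of_graded (graded_term _ _) _ _; lia.
- by move=> k l kK lL; apply: fraction_of_graded (graded_moment (ltnW kK) lL) _ _; lia.
- by rewrite mulSn NB; lia.
- by rewrite mulSn NB; lia.
- by apply: fraction_of_graded graded_KD _ _; lia.
- move=> n nN; apply: (fraction_div graded_KD); rewrite ?pnatr_eq0 //; try lia.
  by apply: (@weak 0 _ tau); [by []|lia|apply: graded_nat; lia].
- by move=> /D_gt0 D0; apply: (fraction_div gN gD) => //; lia.
- by move=> /N_gt0 N0; apply: (fraction_div gD gN) => //; lia.
- move=> k l kK lL; rewrite /scale mulrA; case: (posnP N) => [->|/D_gt0 D0].
    by rewrite mulr0 mul0r; apply: fraction_of_graded g0 _ _; lia.
  apply: (@fraction_div 2 (3 * tau + 3)) => //; try lia.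
  rewrite (_ : 3 * tau + 3 = (2 * tau + 3) + tau)%N; last by lia.
  exact: (@gradedM _ _ 2 0 _ _ _ _ (graded_dif _ _) graded_N).
- move=> k l kK lL; apply: (@fraction_of_graded 0 tau); try lia.
  split; first by rewrite mulr1 intr_int.
  have := round_nearest_le (difq_le DE N_lt eps0 kK lL) => /le_trans; apply.
  by rewrite -natrX ler_nat; lia.
- by move=> k l j kK lL; apply: fraction_of_graded (graded_slot_gen _ _ lL) _ _; lia.
- move=> k i j kK; apply: fraction_of_graded (gradedM (graded_sum_gen i (ltnW kK))
    (graded_slot_gen k j (leqnn L))) _ _; first by lia.
  by have : (tau * k <= tau * K)%N; [rewrite leq_mul // ltnW|lia].
- move=> k i j kK jB.
  apply: fraction_of_graded (graded_conv i (fun i => graded_sum_gen i (ltnW kK)) jB) _ _.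
    by lia.
  by have : (tau * k <= tau * K)%N; [rewrite leq_mul // ltnW|lia].
- by move=> n nW; apply: fraction_of_graded (graded_below nW) _ _; lia.
- by move=> n nW; apply: fraction_of_graded (graded_t_below nW) _ _; lia.
- by move=> n nW; apply: fraction_of_graded (graded_excess nW) _ _; lia.
- by rewrite NB; lia.
- by apply: fraction_of_graded graded_tNK _ _; lia.
- by apply: fraction_of_graded graded_rest _ _; lia.
- case: (posnP N) => [/mesh0->|N0].
    by rewrite mul0r; apply: fraction_of_graded g0 _ _; lia.
  rewrite mesh_rest //; apply: (fraction_div _ gN') => //; last exact: N_gt0.
  by apply: weak gDrest; lia.
- rewrite /result; case: (posnP N) => [/mesh0->|N0].
    rewrite mul0r addr0.
    by apply: fraction_of_graded (graded_moment (leqnn K) (leq0n L)) _ _; lia.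
  rewrite mesh_rest // -{1}[moment _ _ _ _ _ _](mulfK (N_gt0 N0)) -mulrDl.
  apply: (fraction_div _ gN') => //; last exact: N_gt0.
  rewrite [in X in graded _ X](_ : _ + 6 = (3 * tau * K + 6 * tau + 5).+1)%N; last by lia.
  apply: gradedD; last by apply: weak gDrest; lia.
  apply: (@weak 3 _ (5 * tau + 3 + tau)); [lia|lia|].
  exact: (@gradedM _ _ 3 0 _ _ _ _ (graded_moment (leqnn K) (leq0n L)) graded_N).
Qed.
End ProgramSizes.

(** * Accuracy of the rounding *)

Section Rounding.
Variables (R : realType) (K L : nat) (X Y1 Y2 : nat -> R) (eps : R).

Lemma dmax_exists : exists D, dmax_upto K L X Y1 Y2 K 0 D.
Proof.
suff ex k : (k <= K)%N -> exists D, dmax_upto K L X Y1 Y2 k 0 D by exact: ex.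
elim: k => [|k IH] kK.
  by exists 0; split=> // [i j _ _|]; [rewrite ltn0 andbF|left].
suff [D dD] : exists D, dmax_upto K L X Y1 Y2 k L D.
  by exists D; apply: dmax_upto0.
suff ex l : (l <= L)%N -> exists D, dmax_upto K L X Y1 Y2 k l D by exact: ex.
elim: l => [|l IHl] lL; first exact: IH (ltnW kK).
have [D dD] := IHl (ltnW lL).
by exists (Num.max D `|dif L X Y1 Y2 k l|); apply: dmax_uptoS.
Qed.

(** The resolution is the least number that passes the test of the program, not
    just a large enough one: the operation count needs its upper bound. *)
Lemma resolution_exists (c : R) : 0 < eps -> 0 <= c ->
  exists2 N, c / N.+1%:R <= eps & forall n, (n < N)%N -> eps < c / n.+1%:R.
Proof.
move=> eps0 c0.
have ex : exists n, c / n.+1%:R <= eps.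
  exists (Num.truncn (c / eps)); rewrite ler_pdivrMr // mulrC -ler_pdivrMr //.
  have ce : 0 <= c / eps by rewrite divr_ge0 // ltW.
  by have /andP[_ /ltW] := truncn_itv ce.
exists (ex_minn ex); first by case: ex_minnP.
by case: ex_minnP => N _ minN n nN; rewrite ltNge; apply/negP => /minN; rewrite leqNgt nN.
Qed.

Variables (D : R) (N : nat).
Hypothesis DE : dmax_upto K L X Y1 Y2 K 0 D.
Hypothesis N_lt : forall n, (n < N)%N -> eps < K%:R * D / n.+1%:R.
Hypothesis N_ge : K%:R * D / N.+1%:R <= eps.
Hypothesis eps0 : 0 < eps.

Lemma mesh_ge0 : 0 <= mesh D N.
Proof. by have [D0 _ _] := DE; rewrite divr_ge0. Qed.

(** For [N = 0] the bound is [K D <= eps].  Otherwise each of the K terms moves by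
    at most half a mesh, and [K D / (2 N) <= K D / (N + 1) <= eps]. *)
Lemma rounding_dist (f : {ffun 'I_K -> 'I_L}) :
  `|mesh D N * \sum_(k < K) ((slot L X Y1 Y2 D N k (f k))%:R - N%:R)
    - \sum_(k < K) dif L X Y1 Y2 k (f k)| <= eps.
Proof.
have [D0 lb _] := DE.
rewrite mulr_sumr -sumrB; apply: le_trans (ler_norm_sum _ _ _) _.
case: (posnP N) => N0.
  move: N_ge; rewrite N0 divr1; apply: le_trans.
  have -> : K%:R * D = \sum_(k < K) D by rewrite sumr_const card_ord mulr_natl.
  apply: ler_sum => k _.
  by rewrite /mesh invr0 mulr0 mul0r sub0r normrN lb // ltn_ord.
have Nn0 : N%:R != 0 :> R by rewrite pnatr_eq0 -lt0n.
have Dn0 := D_neq0 N_lt eps0 N0.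
apply: le_trans (_ : \sum_(k < K) mesh D N / 2 <= _).
  apply: ler_sum => k _.
  have [e _] := slotE DE N_lt eps0 (ltn_ord k) (ltn_ord (f k)).
  rewrite -e addrK; set v := dif _ _ _ _ _ _ * _.
  have -> : dif L X Y1 Y2 k (f k) = mesh D N * v.
    by rewrite /v /mesh /scale; field; rewrite Nn0 Dn0.
  rewrite -mulrBr normrM (ger0_norm mesh_ge0) ler_wpM2l ?mesh_ge0 //.
  exact: round_nearest_dist.
have -> : \sum_(k < K) mesh D N / 2 = K%:R * D / (2 * N%:R).
  by rewrite sumr_const card_ord -[LHS]mulr_natl /mesh; field.
move: N_ge; rewrite ler_pdivrMr // => h.
have {h} h : K%:R * D <= eps * (2 * N%:R).
  apply: le_trans h _; rewrite ler_wpM2l ?(ltW eps0) // -natrM ler_nat; lia.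
by rewrite ler_pdivrMr // mulr_gt0 ?ltr0n.
Qed.

End Rounding.

Section Arrays.
Variable R : realType.

Lemma mx_arrayE K L (A : 'M[R]_(K, L)) (k : 'I_K) (l : 'I_L) :
  mx_array A (k * L + l) = A k l.
Proof.
have L0 : (0 < L)%N := leq_ltn_trans (leq0n l) (ltn_ord l).
rewrite /mx_array divnMDl // divn_small // addn0 modnMDl modn_small //.
by rewrite !valK.
Qed.

Lemma row_arrayE K (v : 'rV[R]_K) (k : 'I_K) : row_array v k = v 0 k.
Proof. by rewrite /row_array valK. Qed.

Lemma mx_array_ind K L (A : 'M[R]_(K, L)) (P : R -> Prop) n :
  P 0 -> (forall k l, P (A k l)) -> P (mx_array A n).
Proof. by move=> P0 PA; rewrite /mx_array; do 2 case: insub => //. Qed.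

Lemma row_array_ind K (v : 'rV[R]_K) (P : R -> Prop) n :
  P 0 -> (forall k, P (v 0 k)) -> P (row_array v n).
Proof. by move=> P0 Pv; rewrite /row_array; case: insub. Qed.

End Arrays.

(** * Asymptotic bounds *)

Section Log.
Variable R : realType.

Lemma log2_le (r : R) e : 0 < r -> (log2 r <= e%:R) = (r <= 2 ^+ e).
Proof.
move=> r0; have l2 : 0 < ln 2 :> R by rewrite ln_gt0 // ltr1n.
rewrite /log2 ler_pdivrMr // mulr_natl -lnXn // ler_ln // posrE exprn_gt0 //.
Qed.

Lemma log2_natr_ge0 n : (0 < n)%N -> 0 <= log2 n%:R :> R.
Proof.
by move=> n0; rewrite /log2 divr_ge0 // ln_ge0 // ler1n.
Qed.

Lemma log2_ge1 (r : R) : 2 <= r -> 1 <= log2 r.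
Proof.
move=> r2; have l2 : 0 < ln 2 :> R by rewrite ln_gt0 // ltr1n.
have r0 : 0 < r by apply: lt_le_trans r2.
by rewrite /log2 ler_pdivlMr // mul1r ler_ln // posrE.
Qed.

Lemma ceil_log2 (r : R) : 0 < r ->
  exists2 e : nat, r <= 2 ^+ e & e%:R <= Num.max 0 (log2 r) + 1.
Proof.
move=> r0; have m0 : 0 <= Num.max 0 (log2 r) by rewrite le_max lexx.
have /andP[le_tr /ltW tr_le] := truncn_itv m0.
exists (Num.truncn (Num.max 0 (log2 r))).+1; last by rewrite -natr1 lerD2r.
by rewrite -log2_le //; apply: le_trans tr_le; rewrite le_max lexx orbT.
Qed.

End Log.

(** For [N = 0] the table has a single column and the work is O(K L).  For
    positive N, being an integer is what lets K^2 N be absorbed by K^2 N^2; a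
    real resolution below 1 would not allow this. *)
Lemma transport_cost_bound_le K L N : (0 < K)%N -> (0 < L)%N ->
  (transport_cost_bound K L N <= 200 * (K * L) + 900 * (K * N) ^ 2)%N.
Proof.
move=> K0 L0; rewrite /transport_cost_bound /nslots /nsums.
have KL : (K <= K * L)%N by rewrite leq_pmulr.
have K1 : (1 <= K * L)%N by rewrite muln_gt0 K0.
case: N => [|n]; first by rewrite !muln0 /=; lia.
set N := n.+1; have N0 : (0 < N)%N by [].
have NM : (N <= K * N)%N by rewrite leq_pmull.
have KM : (K <= K * N)%N by rewrite leq_pmulr.
have M1 : (1 <= K * N)%N by rewrite muln_gt0 K0.
rewrite -mulnn.
have h1 : (N <= K * N * (K * N))%N by rewrite (leq_trans NM) // leq_pmulr.
have h2 : (K * N <= K * N * (K * N))%N by rewrite leq_pmulr.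
have h3 : (K * N * N <= K * N * (K * N))%N by rewrite leq_mul.
have h4 : (K * (K * N) <= K * N * (K * N))%N by rewrite leq_mul.
have h5 : (K <= K * N * (K * N))%N by rewrite (leq_trans KM) // leq_pmulr.
by clearbody N; lia.
Qed.

Section Bounds.
Variable R : realType.

(** Stated for arbitrary coefficients so that large numerals are never
    computed. *)
Lemma natr_comb_le (a b c n1 n2 : nat) (v w : R) :
  n1%:R <= v -> n2%:R <= c%:R * w -> w <= v ->
  (a * n1 + b * n2)%N%:R <= (a + b * c)%N%:R * v.
Proof.
move=> n1v n2w wv; rewrite !natrD mulrDl !natrM -mulrA.
rewrite lerD ?ler_wpM2l //.
by apply: le_trans n2w _; rewrite ler_wpM2l.
Qed.

(** K L is below the logarithmic term unless K L = 1, when the maximum with 1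
    takes over; (K N)^2 <= K^2 N^4 is below 8^4 times the other term. *)
Lemma ops_le (K L U N : nat) (eps : R) : (0 < K)%N -> (0 < L)%N -> (0 < U)%N ->
  0 < eps -> N%:R * eps <= 8 * K%:R * U%:R ^+ 2 ->
  (transport_cost_bound K L N)%:R <=
    (200 + 900 * 8 ^ 4)%N%:R * Num.max 1
      (K%:R * L%:R * log2 (K%:R * L%:R)
       + K%:R ^+ 6 * U%:R ^+ 8 / eps ^+ 4) :> R.
Proof.
move=> K0 L0 U0 eps0 Neps.
apply: le_trans (_ : (200 * (K * L) + 900 * (K * N) ^ 2)%N%:R <= _).
  by rewrite ler_nat transport_cost_bound_le.
set S1 := _ * log2 _; set S2 := _ / _.
have KL0 : (0 < K * L)%N by rewrite muln_gt0 K0.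
have S1_ge0 : 0 <= S1.
  by apply: mulr_ge0; [rewrite mulr_ge0|rewrite -natrM log2_natr_ge0].
have S2_ge0 : 0 <= S2 by rewrite divr_ge0 ?mulr_ge0 ?exprn_ge0 // ltW.
have hKL : (K * L)%:R <= Num.max 1 (S1 + S2).
  rewrite le_max; have [KL1|KL2] := leqP (K * L) 1.
    by rewrite (_ : K * L = 1)%N ?lexx //; lia.
  apply/orP; right.
  apply: le_trans (_ : S1 <= _); last by rewrite lerDl.
  by rewrite /S1 -natrM -[X in X <= _]mulr1 ler_wpM2l // log2_ge1 // ler_nat.
have hKN : ((K * N) ^ 2)%:R <= (8 ^ 4)%:R * S2.
  apply: le_trans (_ : (K%:R ^+ 2) * (N%:R ^+ 4) <= _).
    rewrite natrX natrM exprMn ler_wpM2l ?exprn_ge0 //.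
    case: N {Neps} => [|N]; first by rewrite !expr0n.
    by rewrite ler_weXn2l // ler1n.
  rewrite /S2 mulrA ler_pdivlMr ?exprn_gt0 // -mulrA -exprMn.
  rewrite natrX (_ : _ * (_ * _) = K%:R ^+ 2 * (8 * K%:R * U%:R ^+ 2) ^+ 4).
    rewrite ler_wpM2l ?exprn_ge0 // lerXn2r // ?nnegrE.
      by rewrite mulr_ge0 // ltW.
    by rewrite !mulr_ge0 ?exprn_ge0.
  by ring.
have hS2 : S2 <= Num.max 1 (S1 + S2) by rewrite le_max lerDr S1_ge0 orbT.
exact: natr_comb_le hKL hKN hS2.
Qed.

Lemma natr_pow_le (c b n : nat) (z : R) : 0 <= z -> b%:R <= 2 * z ->
  (c * b ^ n)%N%:R <= (c * 2 ^ n)%N%:R * z ^+ n.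
Proof.
move=> z0 bz; rewrite !natrM !natrX -mulrA ler_wpM2l // -exprMn.
by rewrite lerXn2r // nnegrE ?mulr_ge0.
Qed.

(** In terms of b = K + L + u + e >= 2, [tau] is at most 5 b and [g] at most
    4 b^3, which makes the size O(b^4). *)
Lemma bits_le (K L u e : nat) (Z : R) : (0 < K)%N -> (0 < L)%N ->
  let tau := (5 + 2 * K + L + 2 * u + e)%N in
  let g := (u * (2 * (K * L) + 2 * K + 1))%N in
  (K + L + u + e)%N%:R <= Z + 2 -> 2 <= Z ->
  (2 * (3 * tau * K + 6 * tau + 6 + g * (K + 3)) + 3)%N%:R
    <= (41 * 2 ^ 4)%N%:R * Z ^+ 4.
Proof.
move=> K0 L0 tau g; set b := (K + L + u + e)%N => bZ Z2.
have b2 : (2 <= b)%N by rewrite /b; lia.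
have taub : (tau <= 5 * b)%N by rewrite /tau /b; lia.
have Kb : (K <= b)%N by rewrite /b; lia.
have Lb : (L <= b)%N by rewrite /b; lia.
have ub : (u <= b)%N by rewrite /b; lia.
clearbody b tau.
have KLb : (K * L <= b * b)%N by rewrite leq_mul.
have bb : (2 * b <= b * b)%N by rewrite leq_mul.
have gb : (g <= b * (4 * (b * b)))%N by rewrite /g leq_mul //; lia.
have gK : (g * (K + 3) <= b * (4 * (b * b)) * (3 * b))%N by rewrite leq_mul //; lia.
have tK : (tau * K <= 5 * b * b)%N by rewrite leq_mul.
have b4 : (4 * (b * b) <= b ^ 4)%N.
  by rewrite (_ : b ^ 4 = b * b * (b * b))%N ?leq_mul //; [lia|rewrite !expnS; lia].
have g4 : (b * (4 * (b * b)) * (3 * b) = 12 * b ^ 4)%N by rewrite !expnS; lia.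
apply: le_trans (_ : (41 * b ^ 4)%N%:R <= _).
  rewrite ler_nat; lia.
rewrite natr_pow_le //; lra.
Qed.

End Bounds.

Lemma is_fraction_graded (R : realType) (Gam U tau : nat) (v : R) :
  is_fraction U v -> v * Gam%:R \is a Num.int -> (U <= 2 ^ tau)%N ->
  graded Gam 1 tau v.
Proof.
move=> /is_fraction_norm vU vi Ut; split; first by rewrite expr1.
by apply: le_trans vU _; rewrite -natrX ler_nat.
Qed.

(** One exponent [tau] for all dimensions and inputs keeps the size estimates
    linear in [tau]. *)
Lemma exponent_bounds K L U N u e :
  let tau := (5 + 2 * K + L + 2 * u + e)%N in
  (0 < K)%N -> (U <= 2 ^ u)%N -> (N <= 2 ^ (3 + K + 2 * u + e))%N ->
  [/\ K <= 2 ^ tau, L <= 2 ^ tau, U <= 2 ^ tau & nsums K N <= 2 ^ tau]%N.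
Proof.
move=> tau K0 Uu Ne.
have exp2 n b : (n <= 2 ^ b)%N -> (b <= tau)%N -> (n <= 2 ^ tau)%N.
  by move=> nb bt; apply: leq_trans nb _; rewrite leq_exp2l.
split.
- by apply: (exp2 _ K); [rewrite ltnW // ltn_expl|rewrite /tau; lia].
- by apply: (exp2 _ L); [rewrite ltnW // ltn_expl|rewrite /tau; lia].
- by apply: exp2 Uu _; rewrite /tau; lia.
have NK : (2 * N * K <= 2 ^ (1 + (3 + K + 2 * u + e) + K))%N.
  by rewrite (expnD 2 _ K) (expnD 2 1) leq_mul // ?leq_mul // ltnW // ltn_expl.
by apply: leq_ltn_trans NK _; rewrite ltn_exp2l // /tau; lia.
Qed.

(** * The theorem *)

Section Link.
Variables (R : realType) (K L N : nat) (x mu : 'M[R]_(K, L)).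
Variables (y1 y2 : 'rV[R]_K) (t eps D : R).
Local Notation X := (mx_array x).
Local Notation M := (mx_array mu).
Local Notation Y1 := (row_array y1).
Local Notation Y2 := (row_array y2).

Lemma dif_entries (k : 'I_K) (l : 'I_L) :
  dif L X Y1 Y2 k l = (x k l - y1 0 k) ^+ 2 - (x k l - y2 0 k) ^+ 2.
Proof. by rewrite /dif /dev mx_arrayE !row_arrayE !expr2. Qed.

Lemma moment_entries :
  moment L X M Y2 K 0 = \sum_k \sum_l mu k l * (x k l - y2 0 k) ^+ 2.
Proof.
rewrite /moment [X in _ + X]big_ord0 addr0; apply: eq_bigr => k _.
apply: eq_bigr => l _.
by rewrite /moment_term /dev !mx_arrayE row_arrayE expr2.
Qed.

Lemma sum_gen_entries :
  sum_gen L X M Y1 Y2 D N K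
    = \prod_k \sum_l mu k l *: 'X^(slot L X Y1 Y2 D N k l).
Proof.
apply: eq_bigr => k _; apply: eq_bigr => l _.
by rewrite mx_arrayE.
Qed.

Lemma dif_bound U (k : nat) (l : nat) : (k < K)%N -> (l < L)%N ->
  (forall k l, is_fraction U (x k l)) ->
  (forall k, is_fraction U (y1 0 k)) -> (forall k, is_fraction U (y2 0 k)) ->
  `|dif L X Y1 Y2 k l| <= 8 * U%:R ^+ 2.
Proof.
move=> kK lL xU y1U y2U; rewrite (dif_entries (Ordinal kK) (Ordinal lL)).
have := is_fraction_norm (xU (Ordinal kK) (Ordinal lL)).
have := is_fraction_norm (y1U (Ordinal kK)).
have := is_fraction_norm (y2U (Ordinal kK)).
rewrite !ler_norml => h1 h2 h3.
set a := x _ _ in h3 *; set b := y1 _ _ in h2 *; set c := y2 _ _ in h1 *.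
move: h1 h2 h3 => /andP[? ?] /andP[? ?] /andP[? ?].
apply/andP; split; nra.
Qed.

End Link.

Theorem theorem4p9 (R : realType) :
  exists (prog : cmd) (C c d : nat),
    forall (K L U : nat) (x mu : 'M[R]_(K, L)) (y1 y2 : 'rV[R]_K) (t eps : R),
      (0 < K)%N -> (0 < L)%N -> (0 < U)%N ->
      (forall k l, 0 <= mu k l) ->
      (forall k, \sum_l mu k l = 1) ->
      0 <= t <= 1 ->
      0 < eps ->
      (forall k l, is_fraction U (mu k l)) ->
      is_fraction U t -> is_fraction U (1 - t) ->
      (forall k l, is_fraction U (x k l)) ->
      (forall k, is_fraction U (y1 0 k)) ->
      (forall k, is_fraction U (y2 0 k)) ->
      exists (s : state R) (tr : trace R),
        [/\ exec prog (input_state x mu y1 y2 t eps) s tr,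
            exists2 W : R,
              is_OT_distance (@sq_dist R K)
                (product_distr x mu) (two_point_distr t y1 y2) W
              & `|output s - W| <= eps,
            (nb_operations tr)%:R <=
              C%:R * Num.max 1
                (K%:R * L%:R * log2 (K%:R * L%:R)
                 + K%:R ^+ 6 * U%:R ^+ 8 / eps ^+ 4)
          & forall v, v \in computed_numbers tr ->
              exists2 q : rat, v = ratr q &
                (rat_bits q)%:R <=
                  c%:R * (K%:R + L%:R + log2 U%:R
                          + Num.max 0 (log2 (1 / eps))) ^+ d].
Proof.
exists transport_prog, (200 + 900 * 8 ^ 4)%N, (41 * 2 ^ 4)%N, 4%N.
move=> K L U x mu y1 y2 t eps K0 L0 U0 mu0 mu1 t01 eps0 muU tU _ xU y1U y2U.
pose X := mx_array x; pose M := mx_array mu.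
pose Y1 := row_array y1; pose Y2 := row_array y2.
have [D DE] := dmax_exists K L X Y1 Y2.
have [D0 lbD witD] := DE.
have [N N_ge N_lt] := resolution_exists eps0 (mulr_ge0 (ler0n R K) D0).
have DU : D <= 8 * U%:R ^+ 2.
  case: witD => [->|[i [j [iK jL ->]]]]; last exact: dif_bound.
  by rewrite mulr_ge0 ?exprn_ge0.
have Neps : N%:R * eps <= 8 * K%:R * U%:R ^+ 2.
  case: N N_lt {N_ge} => [|n] N_lt; first by rewrite mul0r !mulr_ge0 ?exprn_ge0.
  have := N_lt n (leqnn _); rewrite ltr_pdivlMr // mulrC => /ltW/le_trans; apply.
  by rewrite [8 * _]mulrC -mulrA ler_wpM2l.
have [u Uu u_le] : exists2 u : nat, (U <= 2 ^ u)%N & u%:R <= log2 U%:R + 1 :> R.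
  have [|u Uu] := @ceil_log2 R U%:R; first by rewrite ltr0n.
  rewrite max_r ?log2_natr_ge0 // => u_le; exists u => //.
  by rewrite -(ler_nat R) natrX.
have [|e epse e_le] := @ceil_log2 R (1 / eps); first by rewrite divr_gt0.
have Ne : (N <= 2 ^ (3 + K + 2 * u + e))%N.
  have Nle : (N <= 8 * K * U ^ 2 * 2 ^ e)%N.
    rewrite -(ler_nat R) !natrM !natrX -[N%:R](mulfK (lt0r_neq0 eps0)).
    rewrite -[in X in X <= _]div1r; apply: ler_pM => //; first by rewrite mulr_ge0 // ltW.
    by rewrite divr_ge0 // ltW.
  apply: leq_trans Nle _; rewrite (expnD _ _ e) leq_mul // (expnD _ _ (2 * u)).
  apply: leq_mul; first rewrite expnD.
    by rewrite leq_mul // ltnW // ltn_expl.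
  by rewrite (mulnC 2%N) expnM leq_exp2r.
pose tau := (5 + 2 * K + L + 2 * u + e)%N.
pose g := (u * (2 * (K * L) + 2 * K + 1))%N.
pose m := (3 * tau * K + 6 * tau + 6 + g * (K + 3))%N.
have [Ktau Ltau Utau Wtau] := exponent_bounds L K0 Uu Ne.
(* All inputs except the tolerance. *)
pose data := codom (fun p : 'I_K * 'I_L => x p.1 p.2)
  ++ codom (fun p : 'I_K * 'I_L => mu p.1 p.2)
  ++ codom (fun k => y1 0 k) ++ codom (fun k => y2 0 k) ++ [:: t].
have [v|Gam [Gam0 GamU dataG]] := @common_denominator R U data.
  by rewrite !mem_cat => /or4P[/codomP[p ->]|/codomP[p ->]|/codomP[k ->]|/orP[/codomP[k ->]|]] //;
    rewrite inE => /eqP ->.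
have size_data : size data = (2 * (K * L) + 2 * K + 1)%N.
  by rewrite !size_cat !size_codom /= !card_prod !card_ord; ring.
have Gamg : (Gam <= 2 ^ g)%N.
  by apply: leq_trans GamU _; rewrite /g expnM size_data leq_exp2r // addn1.
have in_x k l : x k l \in data.
  by rewrite mem_cat (codom_f (fun p : 'I_K * 'I_L => x p.1 p.2) (k, l)).
have in_mu k l : mu k l \in data.
  by rewrite !mem_cat (codom_f (fun p : 'I_K * 'I_L => mu p.1 p.2) (k, l)) orbT.
have in_y1 k : y1 0 k \in data.
  by rewrite !mem_cat (codom_f (fun k => y1 0 k) k) !orbT.
have in_y2 k : y2 0 k \in data.
  by rewrite !mem_cat (codom_f (fun k => y2 0 k) k) !orbT.
have in_t : t \in data by rewrite !mem_cat mem_head !orbT.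
have gr v : is_fraction U v -> v \in data -> graded Gam 1 tau v.
  by move=> vU vd; exact: is_fraction_graded vU (dataG _ vd) Utau.
have gX n : graded Gam 1 tau (X n).
  by apply: (mx_array_ind (P := graded Gam 1 tau)) => [|k l]; [exact: graded0|exact: gr].
have gM n : graded Gam 1 tau (M n).
  by apply: (mx_array_ind (P := graded Gam 1 tau)) => [|k l]; [exact: graded0|exact: gr].
have gY1 n : graded Gam 1 tau (Y1 n).
  by apply: row_array_ind => [|k]; [exact: graded0|exact: gr].
have gY2 n : graded Gam 1 tau (Y2 n).
  by apply: row_array_ind => [|k]; [exact: graded0|exact: gr].
have gt := gr _ tU in_t.
have ins : inputs K L X M Y1 Y2 t eps (input_state x mu y1 y2 t eps) by [].
have v0 i : (3 < i)%N -> var (input_state x mu y1 y2 t eps) i = 0.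
  by move=> i3; rewrite /= nth_default.
have a0 a n : (3 < a)%N -> arr (input_state x mu y1 y2 t eps) a n = 0.
  by move=> a3; rewrite /= nth_default.
have [s [tr [run len small out]]] := transport_prog_sizes Gam0 gX gY1 gY2 gM
  Ktau Ltau DE K0 Wtau N_lt eps0 gt Gamg N_ge (leqnn m) ins v0 a0.
exists s, tr; split=> //.
- have dG k l : ((x k l - y1 0 k) ^+ 2 - (x k l - y2 0 k) ^+ 2) * (Gam ^ 2)%N%:R
      \is a Num.int.
    have [+ _] : graded Gam 2 (2 * tau + 3) (dif L X Y1 Y2 k l) by apply: graded_dif.
    by rewrite dif_entries natrX.
  have Gam2 : (0 < Gam ^ 2)%N by rewrite expn_gt0 Gam0.
  have slotN (k : 'I_K) (l : 'I_L) : (slot L X Y1 Y2 D N k l <= 2 * N)%N.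
    by have [_] := slotE DE N_lt eps0 (ltn_ord k) (ltn_ord l).
  have dist (f : {ffun 'I_K -> 'I_L}) :
      `|mesh D N * \sum_(k < K) ((slot L X Y1 Y2 D N k (f k))%:R - N%:R)
        - \sum_(k < K) ((x k (f k) - y1 0 k) ^+ 2 - (x k (f k) - y2 0 k) ^+ 2)| <= eps.
    have := rounding_dist DE N_lt N_ge eps0 f; congr (`|_ - _| <= _).
    by apply: eq_bigr => k _; rewrite dif_entries.
  have [W isW distW] := OT_rounded mu0 mu1 t01 (mesh_ge0 N DE) (ltW eps0) Gam2 dG
    slotN dist.
  exists W => //; rewrite out /result moment_entries /excess /mass_below.
  by rewrite sum_gen_entries.
- apply: le_trans (ops_le K0 L0 U0 eps0 Neps); rewrite ler_nat; exact: len.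
- move=> v vtr; have [q -> qm] := is_fraction_bits (small v vtr).
  exists q => //; apply: le_trans (_ : (2 * m + 3)%N%:R <= _); first by rewrite ler_nat.
  set Z := (X in X ^+ 4).
  have logU := log2_natr_ge0 R U0.
  have m0 : 0 <= Num.max 0 (log2 (1 / eps)) by rewrite le_max lexx.
  apply: bits_le => //; rewrite /Z.
    by rewrite !natrD; lra.
  have : 1 <= K%:R :> R by rewrite ler1n.
  have : 1 <= L%:R :> R by rewrite ler1n.
  lra.
Qed.
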